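(* Let $n=2$ and let $\Omega$, $g$, $\kappa$ satisfy hypotheses (H1)–(H4) listed in the context. The approximation scheme $F^h$ described in the context, defined for $x\in\mathcal{G}^h\cap\Omega$ by $$F^h(x,u(x),u(x)-u(\cdot))=\max\Big\{-{\det}^h(D^2u(x))+\kappa(x)\big(1+|\mathcal{D}^hu(x)|^2\big)^{(n+2)/2},\,-\lambda_1^h(D^2u(x))\Big\}$$ and for $x\in\mathcal{G}^h\cap\partial\Omega$ by $F^h(x,u(x),u(x)-u(\cdot))=u(x)-g(x)$, is consistent (with the weak Dirichlet problem for the equation of prescribed Gaussian curvature), monotone, and Lipschitz.
   Context: Hypotheses ($n=2$): (H1) $\Omega\subset\mathbb{R}^n$ is a uniformly convex, bounded, open domain. (H2) $g\in C^0(\partial\Omega)$. (H3) $\kappa:\bar\Omega\to[0,\infty)$ is continuous and bounded. (H4) $\int_\Omega\kappa(x)\,dx<\int_{\mathbb{R}^n}(1+|p|^2)^{-(n+2)/2}\,dp$. Weak Dirichlet operators: for symmetric $X$ with eigenvalues $\lambda_1(X)\le\dots\le\lambda_n(X)$ let $\det^+(X)=\prod_j\max\{\lambda_j(X),0\}$, and $G(x,p,X)=\max\{-\det^+(X)+\kappa(x)(1+|p|^2)^{(n+2)/2},-\lambda_1(X)\}$. Set $F_*(x,z,p,X)=F^*(x,z,p,X)=G(x,p,X)$ for $x\in\Omega$, and $F_*=\min\{z-g(x),G(x,p,X)\}$, $F^*=\max\{z-g(x),G(x,p,X)\}$ for $x\in\partial\Omega$. Properties of schemes $F^h(x,u(x),u(x)-u(\cdot))$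 (arguments: a grid point, a real number, and a function on $\mathcal{G}^h$): - consistent: for any smooth $\phi$ and $x\in\bar\Omega$, $\limsup_{h\to0,\,y\to x,\,z\in\mathcal{G}^h\to x,\,\xi\to0}F^h(z,\phi(y)+\xi,\phi(y)-\phi(\cdot))\le F^*(x,\phi(x),\nabla\phi(x),D^2\phi(x))$ and $\liminf_{h\to0,\,y\to x,\,z\in\mathcal{G}^h\to x,\,\xi\to0}F^h(z,\phi(y)+\xi,\phi(y)-\phi(\cdot))\ge F_*(x,\phi(x),\nabla\phi(x),D^2\phi(x))$; - monotone: $F^h$ is a non-decreasing function of its final two arguments; - Lipschitz: $F^h$ is locally Lipschitz continuous in its final two arguments. Grid: for each small $h>0$, $\mathcal{G}^h\subset\bar\Omega$ is a finite point cloud with resolution parameter $h$, and $\sup_{y\in\Omega}\min_{x\in\mathcal{G}^h}|x-y|\to0$ as $h\to0$. The angular resolution $d\theta$ satisfies $d\theta\approx2\pi h^{1/4}$, with $\pi/(2d\theta)$ an integer, so that $d\theta\to0$ and $h/d\theta\to0$ as $h\to0$. The boundary is sufficiently well resolved: $h_B=\sup_{y\in\partial\Omega}\min_{x\in\mathcal{G}^h\cap\partial\Omega}|x-y|$ is of order $h\,d\theta$, and is such that the neighbours described next exist and make an angle $O(d\theta)$ with the line in question. Neighbours: let $\delta=h(1+\cos(d\theta/2)\cot(d\theta/2)+\sin(d\theta/2))$. For $x_0\in\mathcal{G}^h\cap\Omega$ and a unit vector $\nu$, write points in polar coordinates $(r,\phi)$ about $x_0$ with respect to the axes $x_0+t\nu$,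 $x_0+t\nu^\perp$; for $j=1,\dots,4$ choose $x_j\in\arg\min\{\sin^2\phi:(r,\phi)\in\mathcal{G}^h\cap B(x_0,\delta)\text{ in the }j\text{th quadrant}\}$, with coordinates $(r_j,\phi_j)$, and set $S_j=r_j\sin\phi_j$, $C_j=r_j\cos\phi_j$. Second derivatives: $\mathcal{D}^h_{\nu\nu}u(x_0)=\sum_{j=1}^4a_j(u(x_j)-u(x_0))$, where with $A=C_3S_2-C_2S_3$, $B=C_1S_4-C_4S_1$ and $D=A(C_1^2S_4-C_4^2S_1)-B(C_3^2S_2-C_2^2S_3)$ one has $a_1=2S_4A/D$, $a_2=2S_3B/D$, $a_3=-2S_2B/D$, $a_4=-2S_1A/D$. (In directions aligned with grid points of a Cartesian grid, one uses the centred difference $|\nu|^{-2}(u(x_0+\nu)+u(x_0-\nu)-2u(x_0))$, with $\nu$ then the corresponding grid vector.) Gradient: for the coordinate directions $e_i$, $i=1,2$, write points in polar coordinates $(r,\phi)$ about $x_0$ with respect to the axes $x_0+te_i$, $x_0+te_i^\perp$; for $j=1,\dots,4$ choose the neighbour $x_j^i\in\arg\min\{\sin^2\phi:(r,\phi)\in\mathcal{G}^h\cap B(x_0,\delta)\text{ in the }j\text{th quadrant}\}$ of $x_0$, with coordinates $(r_j^i,\phi_j^i)$, and set $S_j^i=r_j^i\sin\phi_j^i$, $C_j^i=r_j^i\cos\phi_j^i$; then $$|\mathcal{D}^hu(x_0)|^2=\sum_{i=1}^2\max\{b_1^i(u(x_1^i)-u(x_0))+b_4^i(u(x_4^i)-u(x_0)),\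 b_2^i(u(x_2^i)-u(x_0))+b_3^i(u(x_3^i)-u(x_0)),\ 0\}^2,$$ with $b_1=\frac{S_4}{S_1C_4-C_1S_4}$, $b_2=-\frac{S_3}{S_2C_3-C_2S_3}$, $b_3=\frac{S_2}{S_2C_3-C_2S_3}$, $b_4=-\frac{S_1}{S_1C_4-C_1S_4}$ (superscript $i$ omitted); on a uniform grid this is $\sum_i\max\{\frac{u(x)-u(x+he_i)}{h},\frac{u(x)-u(x-he_i)}{h},0\}^2$. Operators: with $V^h=\{\{(\cos(j\,d\theta),\sin(j\,d\theta)),(-\sin(j\,d\theta),\cos(j\,d\theta))\}:j=1,\dots,\frac{\pi}{2d\theta}\}$, let $\det^h(D^2u(x_0))=\min_{\{\nu_1,\nu_2\}\in V^h}\prod_{i=1}^2\max\{\mathcal{D}^h_{\nu_i\nu_i}u(x_0),0\}$ and $\lambda_1^h(D^2u(x_0))=\min\{\mathcal{D}^h_{\nu_i\nu_i}u(x_0):\nu_i=(\cos(i\,d\theta),\sin(i\,d\theta)),\ i=1,\dots,\frac{\pi}{d\theta}\}$. *)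

(* Defs.v *)
From HB Require Import structures.
From mathcomp Require Import all_boot all_order all_algebra.
From mathcomp Require Import all_classical all_reals all_analysis.

Set Implicit Arguments.
Unset Strict Implicit.
Unset Printing Implicit Defensive.

Import Order.TTheory GRing.Theory Num.Theory.
Import numFieldNormedType.Exports.

Local Open Scope classical_set_scope.
Local Open Scope ring_scope.

(* R^2 is the type of pairs, for which the library has the product Lebesgue
   measure.  Its canonical norm is the sup norm: the Euclidean norm is [enorm];
   both induce the same topology. *)
Notation plane R := (R * R)%type.

Definition dot (R : realType) (p q : plane R) : R := p.1 * q.1 + p.2 * q.2.

Definition enorm (R : realType) (p : plane R) : R := Num.sqrt (dot p p).

Definition perp (R : realType) (p : plane R) : plane R := (- p.2, p.1).

Definition unit_dir (R : realType) (t : R) : plane R := (cos t, sin t).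

Definition e1 (R : realType) : plane R := (1, 0).
Definition e2 (R : realType) : plane R := (0, 1).

Definition boundary (R : realType) (Omega : set (plane R)) : set (plane R) :=
  closure Omega `\` interior Omega.

(* Every boundary point lies on a circle of a fixed radius [r] whose disc
   contains [Omega]. *)
Definition uniformly_convex (R : realType) (Omega : set (plane R)) : Prop :=
  convex_set Omega /\
  exists2 r : R, 0 < r & forall x, boundary Omega x ->
    exists2 c, enorm (x - c) = r & Omega `<=` [set y | enorm (y - c) <= r].

(* A domain is open, nonempty and connected; connectedness follows from
   convexity. *)
Definition hypH1 (R : realType) (Omega : set (plane R)) : Prop :=
  [/\ open Omega, Omega !=set0, bounded_set Omega & uniformly_convex Omega].

Definition hypH2 (R : realType) (Omega : set (plane R)) (g : plane R -> R) :
    Prop :=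
  {within boundary Omega, continuous g}.

Definition hypH3 (R : realType) (Omega : set (plane R)) (kappa : plane R -> R) :
    Prop :=
  [/\ {within closure Omega, continuous kappa},
      (forall x, closure Omega x -> 0 <= kappa x) &
      [bounded kappa x | x in closure Omega]].

(* Here and below the exponent (n + 2) / 2 is 2, as n = 2. *)
Definition hypH4 (R : realType) (Omega : set (plane R)) (kappa : plane R -> R) :
    Prop :=
  (\int[lebesgue_measure \x lebesgue_measure]_(x in Omega) (kappa x)%:E <
   \int[lebesgue_measure \x lebesgue_measure]_p
     (((1 + enorm (p : plane R) ^+ 2) ^+ 2)^-1)%:E)%E.

(* Iterated partial derivatives: [true] stands for d/dx_1, [false] for
   d/dx_2. *)
Definition partial (R : realType) (i : bool) (phi : plane R -> R) :
    plane R -> R :=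
  'D_(if i then e1 R else e2 R) phi.

Definition smooth (R : realType) (phi : plane R -> R) : Prop :=
  forall (s : seq bool) (x : plane R),
    differentiable (foldr (@partial R) phi s) x.

Definition grad (R : realType) (phi : plane R -> R) (x : plane R) : plane R :=
  (partial true phi x, partial false phi x).

Definition hess (R : realType) (phi : plane R -> R) (x : plane R) : 'M[R]_2 :=
  \matrix_(i, j) partial (i == 0) (partial (j == 0) phi) x.

(* Smallest and largest eigenvalue; for a symmetric 2 x 2 matrix these are the
   two eigenvalues counted with multiplicity. *)
Definition lambda1 (R : realType) (X : 'M[R]_2) : R :=
  inf [set a | eigenvalue X a].
Definition lambda2 (R : realType) (X : 'M[R]_2) : R :=
  sup [set a | eigenvalue X a].

Definition detp (R : realType) (X : 'M[R]_2) : R :=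
  Num.max (lambda1 X) 0 * Num.max (lambda2 X) 0.

Definition Gop (R : realType) (kappa : plane R -> R)
    (x p : plane R) (X : 'M[R]_2) : R :=
  Num.max (- detp X + kappa x * (1 + enorm p ^+ 2) ^+ 2) (- lambda1 X).

Definition Flow (R : realType) (Omega : set (plane R)) (g kappa : plane R -> R)
    (x : plane R) (z : R) (p : plane R) (X : 'M[R]_2) : R :=
  if x \in Omega then Gop kappa x p X
  else Num.min (z - g x) (Gop kappa x p X).

Definition Fup (R : realType) (Omega : set (plane R)) (g kappa : plane R -> R)
    (x : plane R) (z : R) (p : plane R) (X : 'M[R]_2) : R :=
  if x \in Omega then Gop kappa x p X
  else Num.max (z - g x) (Gop kappa x p X).

(* The discretisation at every resolution h:
   - [grid h] is the point cloud;
   - [nang h] is the integer pi / (2 dtheta);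
   - [nbr h x0 nu j] and [gnbr h x0 e j], for j = 1, ..., 4, are the neighbours
     chosen in the j-th quadrant for the second derivative in direction nu and
     for the first derivative in direction e;
   - [aligned h x0 nu] is [Some w] when the centred difference with grid vector
     w is used in the direction nu, and [None] when the four neighbours are. *)
Record discretisation (R : realType) := Discretisation {
  grid : R -> seq (plane R) ;
  nang : R -> nat ;
  nbr : R -> plane R -> plane R -> nat -> plane R ;
  gnbr : R -> plane R -> plane R -> nat -> plane R ;
  aligned : R -> plane R -> plane R -> option (plane R) }.

Definition dtheta (R : realType) (D : discretisation R) (h : R) : R :=
  pi / (2 * (nang D h)%:R).

Definition delta (R : realType) (D : discretisation R) (h : R) : R :=
  let t := dtheta D h / 2 in h * (1 + cos t * (cos t / sin t) + sin t).

(* [coorC x0 nu x] = r cos phi and [coorS x0 nu x] = r sin phi, where (r, phi)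
   are the polar coordinates of [x] about [x0] with respect to the axes
   nu, nu^perp, for a unit vector nu. *)
Definition coorC (R : realType) (x0 nu x : plane R) : R := dot (x - x0) nu.
Definition coorS (R : realType) (x0 nu x : plane R) : R :=
  dot (x - x0) (perp nu).

Definition sinphi (R : realType) (x0 nu x : plane R) : R :=
  coorS x0 nu x / enorm (x - x0).

(* The j-th quadrant is (j - 1) pi / 2 <= phi < j pi / 2.  The half-open
   convention puts every x <> x0 in exactly one quadrant; it makes all the
   denominators below nonzero, also when some neighbours lie on an axis. *)
Definition in_quadrant (R : realType) (j : nat) (C S : R) : bool :=
  match j with
  | 1 => (0 < C) && (0 <= S)
  | 2 => (C <= 0) && (0 < S)
  | 3 => (C < 0) && (S <= 0)
  | 4 => (0 <= C) && (S < 0)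
  | _ => false
  end.

Definition candidate (R : realType) (D : discretisation R) (h : R)
    (x0 nu : plane R) (j : nat) (x : plane R) : Prop :=
  [/\ x \in grid D h, enorm (x - x0) < delta D h &
      in_quadrant j (coorC x0 nu x) (coorS x0 nu x)].

Definition is_neighbour (R : realType) (D : discretisation R) (h : R)
    (x0 nu : plane R) (j : nat) (x : plane R) : Prop :=
  candidate D h x0 nu j x /\
  forall y, candidate D h x0 nu j y ->
    sinphi x0 nu x ^+ 2 <= sinphi x0 nu y ^+ 2.

(* The angle between x - x0 and the line x0 + R nu. *)
Definition line_angle (R : realType) (x0 nu x : plane R) : R :=
  asin `|sinphi x0 nu x|.

Definition grid_vector (R : realType) (s : R) (w : plane R) : Prop :=
  exists i j : int, w = (s * i%:~R, s * j%:~R).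

Definition cartesian (R : realType) (Omega : set (plane R))
    (X : seq (plane R)) (s : R) : Prop :=
  0 < s /\ exists o, forall x, Omega x -> x \in X <-> grid_vector s (x - o).

Definition is_aligned (R : realType) (Omega : set (plane R))
    (D : discretisation R) (h : R) (x0 nu w : plane R) : Prop :=
  [/\ exists2 s, cartesian Omega (grid D h) s & grid_vector s w,
      exists2 t, 0 < t & w = t *: nu,
      x0 + w \in grid D h, x0 - w \in grid D h & enorm w < delta D h].

(* The directions (cos (j dtheta), sin (j dtheta)), j = 1, ..., pi / dtheta.
   Every vector of every pair in V^h is one of them. *)
Definition direction (R : realType) (D : discretisation R) (h : R)
    (nu : plane R) : Prop :=
  exists2 j : nat, (1 <= j <= 2 * nang D h)%N &
    nu = unit_dir (j%:R * dtheta D h).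

Definition coord_direction (R : realType) (e : plane R) : Prop :=
  e = e1 R \/ e = e2 R.

(* The suprema and minima are taken in the extended reals, where the minimum
   over the empty set is +oo. *)
Definition covering_radius (R : realType) (A B : set (plane R)) : \bar R :=
  ereal_sup [set ereal_inf [set (enorm (x - y))%:E | x in B] | y in A].

Record grid_hyp (R : realType) (Omega : set (plane R)) (D : discretisation R)
    (h0 : R) : Prop := GridHyp {
  grid_h0 : 0 < h0 ;
  grid_sub : forall h, 0 < h < h0 ->
    forall x, x \in grid D h -> closure Omega x ;
  grid_dense :
    (fun h => covering_radius Omega [set` grid D h]) @ 0^'+ --> 0%E ;
  grid_nang : forall h, 0 < h < h0 -> (0 < nang D h)%N ;
  grid_dtheta :
    (fun h => dtheta D h / (2 * pi * h `^ 4^-1)) @ 0^'+ --> (1 : R) ;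
  grid_boundary : exists K : R, \forall h \near 0^'+,
    (covering_radius (boundary Omega)
       ([set` grid D h] `&` boundary Omega) <= (K * (h * dtheta D h))%:E)%E ;
  grid_stencil : forall h, 0 < h < h0 ->
    forall x0 nu, x0 \in grid D h -> Omega x0 -> direction D h nu ->
    if aligned D h x0 nu is Some w then is_aligned Omega D h x0 nu w
    else forall j, (1 <= j <= 4)%N ->
         is_neighbour D h x0 nu j (nbr D h x0 nu j) ;
  grid_gstencil : forall h, 0 < h < h0 ->
    forall x0 e, x0 \in grid D h -> Omega x0 -> coord_direction e ->
    forall j, (1 <= j <= 4)%N -> is_neighbour D h x0 e j (gnbr D h x0 e j) ;
  grid_angle : exists K : R, \forall h \near 0^'+,
    forall x0 nu j, x0 \in grid D h -> Omega x0 -> direction D h nu ->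
    aligned D h x0 nu = None -> (1 <= j <= 4)%N ->
    line_angle x0 nu (nbr D h x0 nu j) <= K * dtheta D h ;
  grid_gangle : exists K : R, \forall h \near 0^'+,
    forall x0 e j, x0 \in grid D h -> Omega x0 -> coord_direction e ->
    (1 <= j <= 4)%N ->
    line_angle x0 e (gnbr D h x0 e j) <= K * dtheta D h }.

Definition second_diff4 (R : realType) (x : nat -> plane R) (u : plane R -> R)
    (x0 nu : plane R) : R :=
  let C j := coorC x0 nu (x j) in
  let S j := coorS x0 nu (x j) in
  let A := C 3%N * S 2%N - C 2%N * S 3%N in
  let B := C 1%N * S 4%N - C 4%N * S 1%N in
  let d := A * (C 1%N ^+ 2 * S 4%N - C 4%N ^+ 2 * S 1%N)
           - B * (C 3%N ^+ 2 * S 2%N - C 2%N ^+ 2 * S 3%N) in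
  let a1 := 2 * S 4%N * A / d in
  let a2 := 2 * S 3%N * B / d in
  let a3 := - (2 * S 2%N * B) / d in
  let a4 := - (2 * S 1%N * A) / d in
  a1 * (u (x 1%N) - u x0) + a2 * (u (x 2%N) - u x0)
  + a3 * (u (x 3%N) - u x0) + a4 * (u (x 4%N) - u x0).

Definition centred_diff (R : realType) (w : plane R) (u : plane R -> R)
    (x0 : plane R) : R :=
  (enorm w ^+ 2)^-1 * (u (x0 + w) + u (x0 - w) - 2 * u x0).

Definition second_diff (R : realType) (D : discretisation R) (h : R)
    (u : plane R -> R) (x0 nu : plane R) : R :=
  if aligned D h x0 nu is Some w then centred_diff w u x0
  else second_diff4 (nbr D h x0 nu) u x0 nu.

Definition slope (R : realType) (x : nat -> plane R) (u : plane R -> R)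
    (x0 e : plane R) : R :=
  let C j := coorC x0 e (x j) in
  let S j := coorS x0 e (x j) in
  let b1 := S 4%N / (S 1%N * C 4%N - C 1%N * S 4%N) in
  let b2 := - (S 3%N / (S 2%N * C 3%N - C 2%N * S 3%N)) in
  let b3 := S 2%N / (S 2%N * C 3%N - C 2%N * S 3%N) in
  let b4 := - (S 1%N / (S 1%N * C 4%N - C 1%N * S 4%N)) in
  Num.max (Num.max (b1 * (u (x 1%N) - u x0) + b4 * (u (x 4%N) - u x0))
                   (b2 * (u (x 2%N) - u x0) + b3 * (u (x 3%N) - u x0))) 0.

Definition grad_sq (R : realType) (D : discretisation R) (h : R)
    (u : plane R -> R) (x0 : plane R) : R :=
  slope (gnbr D h x0 (e1 R)) u x0 (e1 R) ^+ 2
  + slope (gnbr D h x0 (e2 R)) u x0 (e2 R) ^+ 2.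

(* min {F 1, ..., F n}, for n >= 1 *)
Definition min_upto (R : realType) (n : nat) (F : nat -> R) : R :=
  \big[Num.min/F 1%N]_(1 <= j < n.+1) F j.

Definition det_h (R : realType) (D : discretisation R) (h : R)
    (u : plane R -> R) (x0 : plane R) : R :=
  min_upto (nang D h) (fun j =>
    let nu := unit_dir (j%:R * dtheta D h) in
    Num.max (second_diff D h u x0 nu) 0
    * Num.max (second_diff D h u x0 (perp nu)) 0).

Definition lambda1_h (R : realType) (D : discretisation R) (h : R)
    (u : plane R -> R) (x0 : plane R) : R :=
  min_upto (2 * nang D h) (fun j =>
    second_diff D h u x0 (unit_dir (j%:R * dtheta D h))).

(* A scheme (h, x, z, v) |-> F^h(x, z, v), to be evaluated at z = u(x) and
   v = u(x) - u(.). *)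
Definition scheme (R : realType) :=
  R -> plane R -> R -> (plane R -> R) -> R.

(* A difference function v = c - u(.) determines the increments of u by
   u(y) - u(x) = v(x) - v(y): the difference operators, which only involve
   increments, are applied to -v = u - c.  In particular
   [Fh h x (u x) (fun y => u x - u y)] is the value of the scheme at u. *)
Definition Fh (R : realType) (Omega : set (plane R)) (g kappa : plane R -> R)
    (D : discretisation R) : scheme R := fun h x z v =>
  if x \in Omega then
    let u := fun y => - v y in
    Num.max (- det_h D h u x + kappa x * (1 + grad_sq D h u x) ^+ 2)
            (- lambda1_h D h u x)
  else z - g x.

(* h -> 0+, y -> x, z -> x with z in G^h, xi -> 0 *)
Definition consistency_filter (R : realType) (G : R -> seq (plane R))
    (x : plane R) : set_system (R * plane R * plane R * R) :=
  within [set q | 0 < q.1.1.1 /\ q.1.2 \in G q.1.1.1]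
    (nbhs ((0 : R), x, x, (0 : R))).

Definition consistent (R : realType) (Omega : set (plane R))
    (G : R -> seq (plane R)) (F : scheme R)
    (Flo Fhi : plane R -> R -> plane R -> 'M[R]_2 -> R) : Prop :=
  forall phi : plane R -> R, smooth phi -> forall x, closure Omega x ->
  let T := fun q : R * plane R * plane R * R =>
    let: (h, y, z, xi) := q in
    (F h z (phi y + xi) (fun y' => phi y - phi y'))%:E in
  (limf_esup T (consistency_filter G x)
     <= (Fhi x (phi x) (grad phi x) (hess phi x))%:E)%E /\
  ((Flo x (phi x) (grad phi x) (hess phi x))%:E
     <= limf_einf T (consistency_filter G x))%E.

(* The value at x itself of the last argument u(x) - u(.) is not a variable of
   the scheme, being always 0: it is kept fixed. *)
Definition monotone_scheme (R : realType) (G : R -> seq (plane R)) (h0 : R)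
    (F : scheme R) : Prop :=
  forall h x, 0 < h < h0 -> x \in G h ->
  forall (z z' : R) (v v' : plane R -> R),
    z <= z' -> v x = v' x -> (forall y, y \in G h -> v y <= v' y) ->
    F h x z v <= F h x z' v'.

(* Functions on G^h carry the maximum norm. *)
Definition dist_args (R : realType) (X : seq (plane R))
    (z z' : R) (v v' : plane R -> R) : R :=
  Num.max `|z - z'| (\big[Num.max/0]_(y <- X) `|v y - v' y|).

Definition lipschitz_scheme (R : realType) (G : R -> seq (plane R)) (h0 : R)
    (F : scheme R) : Prop :=
  forall h x, 0 < h < h0 -> x \in G h ->
  forall (z0 : R) (v0 : plane R -> R),
  exists r L : R, 0 < r /\
    forall (z z' : R) (v v' : plane R -> R),
      dist_args (G h) z z0 v v0 < r -> dist_args (G h) z' z0 v' v0 < r ->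
      `|F h x z v - F h x z' v'| <= L * dist_args (G h) z z' v v'.

(* Main.v *)
Require Import Defs.
From HB Require Import structures.
From mathcomp Require Import all_boot all_order all_algebra.
From mathcomp Require Import all_classical all_reals all_analysis.
From mathcomp Require Import ring lra.

Set Implicit Arguments.
Unset Strict Implicit.
Unset Printing Implicit Defensive.

Import Order.TTheory GRing.Theory Num.Theory.
Import numFieldNormedType.Exports.

Local Open Scope classical_set_scope.
Local Open Scope ring_scope.

(** Every difference quotient in the scheme is a sum of increments u(x_j) - u(x)
    with weights of constant sign.  For the second difference along nu the
    weights are nonnegative, their first moments vanish and their second moment
    along nu is 2 (lemma second_diff_stencil), both for the four neighbours and
    for the centred difference; for the one-sided slopes the weights have first
    moment 1 or -1 along the axis and 0 across it (lemma slope_stencil).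

    Monotonicity and the Lipschitz property follow from this form alone.  The
    scheme is nondecreasing in u(x) - u(.) because all the weights have the right
    sign (monotone_Fh), and it is locally Lipschitz because it is built from
    finitely many values of u by sums, products, maxima and minima
    (lipschitz_Fh).

    For consistency, a smooth phi is expanded by Taylor's formula with an error
    that is uniform for base points near x (taylor1, taylor2).  Neighbours make a
    small angle with the line along nu, so the moment conditions turn the
    expansion into the second derivative along nu, up to an error that is small
    uniformly in nu (wsum_second_order, second_diff_near); in the same way the
    slopes tend to the absolute values of the partial derivatives (slope_near).
    The neighbours approach the base point since the stencil radius is of order
    h / dtheta, that is h^(3/4) (delta_near).

    It remains to compare minima over discrete directions with eigenvalues.  The
    Hessian is symmetric (partial_sym).  For a symmetric 2 x 2 matrix, lambda1 is
    the minimum of the quadratic form over unit vectors, and det^+ is the minimum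
    over orthonormal pairs of the product of the positive parts of its two values
    (lambda1_le_quad, lambda1_attained, detp_le, detp_attained).  The quadratic
    form is Lipschitz in the angle and the discrete angles are dtheta-dense, so
    the discrete minima converge (cvg_lambda1_h, cvg_det_h).

    Hence the scheme tends to G along interior grid points.  Along boundary grid
    points it tends to phi(x) - g(x), since g is continuous there.  The lower and
    upper operators are the minimum and maximum of these two limits, which gives
    the two consistency inequalities (consistent_Fh). *)

(** * Minima over finitely many directions *)

Lemma min_upto_le (R : realType) (n : nat) (F : nat -> R) (j : nat) :
  (1 <= j <= n)%N -> min_upto n F <= F j.
Proof.
move=> jn; rewrite /min_upto; apply: (@ge_bigmin_seq _ _ _ _ _ j) => //.
by rewrite mem_index_iota ltnS.
Qed.

Lemma le_min_upto (R : realType) (n : nat) (F : nat -> R) (c : R) :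
  (0 < n)%N -> (forall j, (1 <= j <= n)%N -> c <= F j) -> c <= min_upto n F.
Proof.
move=> n0 cF; rewrite /min_upto big_nat_cond; apply: le_bigmin => [|j].
  exact: cF.
by rewrite ltnS andbT; exact: cF.
Qed.

Lemma ler_min_upto (R : realType) (n : nat) (F G : nat -> R) :
  (0 < n)%N -> (forall j, (1 <= j <= n)%N -> F j <= G j) ->
  min_upto n F <= min_upto n G.
Proof.
move=> n0 FG; apply: le_min_upto => // j jn.
exact: le_trans (min_upto_le _ jn) (FG _ jn).
Qed.

(** * Difference quotients as sums of weighted increments *)

Definition wsum (R : realType) (s : seq (R * plane R)) (u : plane R -> R)
    (x0 : plane R) : R :=
  \sum_(q <- s) q.1 * (u q.2 - u x0).

(** The coefficients of the four-neighbour second difference are determined by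
    the moment conditions: the two first-order moments vanish and the second
    moment along nu is 2, so that the quotient is exact on quadratic functions
    of the coordinate along nu.  The signs of the coordinates in the four
    quadrants make the weights nonnegative and the common denominator d
    positive. *)
Lemma second_diff4_stencil (R : realType) (x : nat -> plane R)
    (x0 nu : plane R) :
  (forall j, (1 <= j <= 4)%N ->
     in_quadrant j (coorC x0 nu (x j)) (coorS x0 nu (x j))) ->
  exists a : nat -> R,
  let s := [seq (a j, x j) | j <- [:: 1; 2; 3; 4]%N] in
  [/\ forall j, j \in [:: 1; 2; 3; 4]%N -> 0 <= a j,
      forall u, second_diff4 x u x0 nu = wsum s u x0,
      \sum_(q <- s) q.1 * coorC x0 nu q.2 = 0,
      \sum_(q <- s) q.1 * coorS x0 nu q.2 = 0 &
      \sum_(q <- s) q.1 * coorC x0 nu q.2 ^+ 2 = 2].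
Proof.
move=> quad.
have /andP[C1 S1] := quad 1%N isT; have /andP[C2 S2] := quad 2%N isT.
have /andP[C3 S3] := quad 3%N isT; have /andP[C4 S4] := quad 4%N isT.
pose C j := coorC x0 nu (x j); pose S j := coorS x0 nu (x j).
rewrite -!/(C _) -!/(S _) in C1 S1 C2 S2 C3 S3 C4 S4.
pose A := C 3%N * S 2%N - C 2%N * S 3%N.
pose B := C 1%N * S 4%N - C 4%N * S 1%N.
pose E := C 1%N ^+ 2 * S 4%N - C 4%N ^+ 2 * S 1%N.
pose G := C 3%N ^+ 2 * S 2%N - C 2%N ^+ 2 * S 3%N.
pose d := A * E - B * G.
have A0 : A < 0.
  by rewrite /A subr_lt0 (lt_le_trans (y := 0)) ?nmulr_rlt0 ?mulr_le0.
have B0 : B < 0.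
  by rewrite /B subr_lt0 (lt_le_trans (y := 0)) ?pmulr_rlt0 ?mulr_ge0.
have E0 : E < 0.
  rewrite /E subr_lt0 (lt_le_trans (y := 0)) ?pmulr_rlt0 ?exprn_gt0 //.
  by rewrite mulr_ge0 ?sqr_ge0.
have G0 : 0 < G.
  rewrite /G subr_gt0 (le_lt_trans (y := 0)) ?mulr_ge0_le0 ?sqr_ge0 //.
  by rewrite mulr_gt0 // exprn_even_gt0 //= lt_eqF.
have d0 : 0 < d.
  by rewrite /d subr_gt0 (lt_trans (y := 0)) ?nmulr_rlt0 // nmulr_rgt0.
have dn0 : d != 0 by rewrite gt_eqF.
pose a j := match j with
  | 1%N => 2 * S 4%N * A / d | 2%N => 2 * S 3%N * B / d
  | 3%N => - (2 * S 2%N * B) / d | _ => - (2 * S 1%N * A) / d end.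
exists a; split.
- move=> j; rewrite !inE => /or4P[] /eqP ->; rewrite /a divr_ge0 ?(ltW d0) //.
  + by rewrite mulr_le0 ?(ltW A0) // nmulr_lle0.
  + by rewrite mulr_le0 ?(ltW B0) // pmulr_rle0.
  + by rewrite oppr_ge0 mulr_ge0_le0 ?(ltW B0) // mulr_ge0 // ltW.
  + by rewrite oppr_ge0 mulr_ge0_le0 ?(ltW A0) // mulr_ge0 // ltW.
- move=> u; rewrite /wsum /= !big_cons big_nil addr0 !addrA.
  by rewrite /second_diff4.
- rewrite /= !big_cons big_nil addr0 /= -!/(C _) /a; apply: (mulfI dn0).
  by rewrite /A /B; field.
- rewrite /= !big_cons big_nil addr0 /= -!/(S _) /a; apply: (mulfI dn0).
  by rewrite /A /B; field.
- rewrite /= !big_cons big_nil addr0 /= -!/(C _) /a; apply: (mulfI dn0).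
  have -> : 2 = 2 * d / d by field.
  by rewrite /d /E /G /A /B; field.
Qed.
Lemma dot_ge0 (R : realType) (p : plane R) : 0 <= dot p p.
Proof. by rewrite /dot -!expr2 addr_ge0 ?sqr_ge0. Qed.

Lemma enorm_sqr (R : realType) (p : plane R) : enorm p ^+ 2 = dot p p.
Proof. by rewrite /enorm sqr_sqrtr ?dot_ge0. Qed.

Lemma dot_unit_dir (R : realType) (t : R) : dot (unit_dir t) (unit_dir t) = 1.
Proof. by rewrite /dot /unit_dir /= -!expr2 cos2Dsin2. Qed.

Lemma dot_direction (R : realType) (D : discretisation R) (h : R)
    (nu : plane R) : direction D h nu -> dot nu nu = 1.
Proof. by case=> j _ ->; rewrite dot_unit_dir. Qed.

Lemma perp_unit_dir (R : realType) (t : R) :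
  perp (unit_dir t) = unit_dir (t + pi / 2).
Proof. by rewrite /perp /unit_dir cosDpihalf sinDpihalf. Qed.

Lemma nang_dtheta (R : realType) (D : discretisation R) (h : R) :
  (0 < nang D h)%N -> (nang D h)%:R * dtheta D h = pi / 2.
Proof.
move=> n0; rewrite /dtheta.
have : (nang D h)%:R != 0 :> R by rewrite pnatr_eq0 -lt0n.
by move=> ?; field.
Qed.

Lemma direction_unit_dir (R : realType) (D : discretisation R) (h : R)
    (j : nat) :
  (1 <= j <= nang D h)%N -> direction D h (unit_dir (j%:R * dtheta D h)).
Proof.
move=> /andP[j1 jn]; exists j => //; rewrite j1 /= (leq_trans jn) //.
by rewrite leq_pmull.
Qed.

Lemma direction_perp (R : realType) (D : discretisation R) (h : R)
    (j : nat) :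
  (1 <= j <= nang D h)%N -> direction D h (perp (unit_dir (j%:R * dtheta D h))).
Proof.
move=> /andP[j1 jn]; exists (j + nang D h)%N.
  by rewrite addn_gt0 j1 /= mul2n -addnn leq_add2r.
rewrite perp_unit_dir natrD [in RHS]mulrDl nang_dtheta //.
exact: leq_trans jn.
Qed.

(** The centred difference satisfies the same moment conditions as the
    four-neighbour one, which lets both be treated alike from here on. *)
Lemma centred_diff_stencil (R : realType) (x0 nu w : plane R) (t : R) :
  0 < t -> w = t *: nu -> dot nu nu = 1 ->
  let s := [:: (t ^- 2, x0 + w); (t ^- 2, x0 - w)] in
  [/\ forall u, centred_diff w u x0 = wsum s u x0,
      \sum_(q <- s) q.1 * coorC x0 nu q.2 = 0,
      (forall q, q \in s -> coorS x0 nu q.2 = 0) &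
      \sum_(q <- s) q.1 * coorC x0 nu q.2 ^+ 2 = 2].
Proof.
move=> t0 -> nu1 s; have tn0 : t != 0 by rewrite gt_eqF.
have Cp : coorC x0 nu (x0 + t *: nu) = t.
  by rewrite /coorC addrC addKr -[RHS]mulr1 -nu1 /dot /= mulrDr !mulrA.
have Cm : coorC x0 nu (x0 - t *: nu) = - t.
  rewrite /coorC addrC addKr -[in RHS](mulr1 t) -nu1 /dot /=.
  by rewrite mulrDr opprD !mulNr !mulrA.
split.
- move=> u; rewrite /wsum /centred_diff !big_cons big_nil addr0 /=.
  rewrite enorm_sqr (_ : dot _ _ = t ^+ 2); first by ring.
  by rewrite -[RHS]mulr1 -nu1 /dot /=; rewrite /GRing.scale /=; ring.
- by rewrite !big_cons big_nil addr0 /= Cp Cm; ring.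
- move=> q; rewrite !inE => /orP[] /eqP ->;
    rewrite /coorS /dot /perp /= /GRing.scale /=; ring.
- by rewrite !big_cons big_nil addr0 /= Cp Cm; field.
Qed.

(** What monotonicity, Lipschitz continuity and consistency use of a second
    difference.  A stencil point either lies on the line x0 + R nu or is one of
    the four neighbours, whose angle with that line is controlled. *)
Definition stencil_for (R : realType) (D : discretisation R) (h : R)
    (x0 nu : plane R) (s : seq (R * plane R)) : Prop :=
  [/\ forall u, second_diff D h u x0 nu = wsum s u x0,
      forall q, q \in s ->
        [/\ 0 <= q.1, q.2 \in grid D h, enorm (q.2 - x0) < delta D h &
            coorS x0 nu q.2 = 0 \/ aligned D h x0 nu = None /\
              exists2 j, (1 <= j <= 4)%N & q.2 = nbr D h x0 nu j],
      \sum_(q <- s) q.1 * coorC x0 nu q.2 = 0,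
      \sum_(q <- s) q.1 * coorS x0 nu q.2 = 0 &
      \sum_(q <- s) q.1 * coorC x0 nu q.2 ^+ 2 = 2].

Lemma second_diff_stencil (R : realType) (Omega : set (plane R))
    (D : discretisation R) (h0 h : R) (x0 nu : plane R) :
  grid_hyp Omega D h0 -> 0 < h < h0 -> x0 \in grid D h -> Omega x0 ->
  direction D h nu -> exists s, stencil_for D h x0 nu s.
Proof.
move=> HG hh x0G x0O dnu; have nu1 := dot_direction dnu.
have := grid_stencil HG hh x0G x0O dnu.
rewrite /stencil_for /second_diff; case: (aligned D h x0 nu) => [w|].
- case=> _ [t t0 wt] wp wm wd.
  have [sE sC sS sCC] := centred_diff_stencil x0 t0 wt nu1.
  exists [:: (t ^- 2, x0 + w); (t ^- 2, x0 - w)]; split => //.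
  + move=> q qs; have Sq := sS _ qs; split; last by left.
    * by move: qs; rewrite !inE => /orP[] /eqP -> /=;
        rewrite invr_ge0 exprn_ge0 ?ltW.
    * by move: qs; rewrite !inE => /orP[] /eqP -> /=.
    * move: qs; rewrite !inE => /orP[] /eqP -> /=; rewrite addrC addKr //.
      by rewrite /enorm (_ : dot _ _ = dot w w) // /dot /= !mulrNN.
  + by rewrite big_seq big1 // => q /sS ->; rewrite mulr0.
- move=> nb; have [|a [a0 aE aC aS aCC]] :=
    @second_diff4_stencil R (nbr D h x0 nu) x0 nu.
    by move=> j /nb[] [].
  exists [seq (a j, nbr D h x0 nu j) | j <- [:: 1; 2; 3; 4]%N]; split => //.
  move=> q /mapP[j js ->] /=.
  have j4 : (1 <= j <= 4)%N by move: js; rewrite !inE => /or4P[] /eqP ->.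
  have [[xG xd _] _] := nb _ j4.
  by split => //; [exact: a0|right; split => //; exists j].
Qed.

(** Both one-sided quotients in the slope are minus a nonnegative combination
    of increments.  The moments say that the combination over the neighbours 1
    and 4 approximates the derivative along e, the one over 2 and 3 its
    opposite. *)
Lemma slope_stencil (R : realType) (x : nat -> plane R) (x0 e : plane R) :
  (forall j, (1 <= j <= 4)%N ->
     in_quadrant j (coorC x0 e (x j)) (coorS x0 e (x j))) ->
  exists b : nat -> R,
  let sp := [seq (b j, x j) | j <- [:: 1; 4]%N] in
  let sm := [seq (b j, x j) | j <- [:: 2; 3]%N] in
  [/\ forall j, (1 <= j <= 4)%N -> 0 <= b j,
      forall u, slope x u x0 e =
        Num.max (Num.max (- wsum sp u x0) (- wsum sm u x0)) 0,
      (\sum_(q <- sp) q.1 * coorC x0 e q.2 = 1) /\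
      (\sum_(q <- sp) q.1 * coorS x0 e q.2 = 0) &
      (\sum_(q <- sm) q.1 * coorC x0 e q.2 = -1) /\
      (\sum_(q <- sm) q.1 * coorS x0 e q.2 = 0)].
Proof.
move=> quad.
have /andP[C1 S1] := quad 1%N isT; have /andP[C2 S2] := quad 2%N isT.
have /andP[C3 S3] := quad 3%N isT; have /andP[C4 S4] := quad 4%N isT.
pose C j := coorC x0 e (x j); pose S j := coorS x0 e (x j).
rewrite -!/(C _) -!/(S _) in C1 S1 C2 S2 C3 S3 C4 S4.
pose p := S 1%N * C 4%N - C 1%N * S 4%N.
pose m := S 2%N * C 3%N - C 2%N * S 3%N.
have p0 : 0 < p.
  by rewrite /p subr_gt0 (lt_le_trans (y := 0)) ?pmulr_rlt0 ?mulr_ge0.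
have m0 : m < 0.
  by rewrite /m subr_lt0 (lt_le_trans (y := 0)) ?pmulr_rlt0 ?mulr_le0.
have pn0 : p != 0 by rewrite gt_eqF.
have mn0 : m != 0 by rewrite lt_eqF.
pose b j := match j with
  | 1%N => - (S 4%N / p) | 2%N => S 3%N / m
  | 3%N => - (S 2%N / m) | _ => S 1%N / p end.
exists b; split.
- case=> [|[|[|[|[|//]]]]] // _; rewrite /b.
  + by rewrite oppr_ge0 mulr_le0_ge0 ?invr_ge0 ?ltW.
  + by rewrite mulr_le0 ?invr_le0 ?(ltW m0).
  + by rewrite oppr_ge0 mulr_ge0_le0 ?invr_le0 ?ltW.
  + by rewrite mulr_ge0 ?invr_ge0 ?(ltW p0).
- move=> u; rewrite /wsum /= !big_cons !big_nil !addr0 /slope -!/(C _) -!/(S _).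
  by rewrite /b !opprD /= !mulNr !opprK.
- by rewrite /= !big_cons !big_nil !addr0 /= -!/(C _) -!/(S _) /b; split;
    rewrite /p; field.
- by rewrite /= !big_cons !big_nil !addr0 /= -!/(C _) -!/(S _) /b; split;
    rewrite /m; field.
Qed.

(** * Monotonicity *)

Lemma ler_wsum (R : realType) (s : seq (R * plane R)) (u u' : plane R -> R)
    (x0 : plane R) :
  (forall q, q \in s -> 0 <= q.1 /\ u q.2 <= u' q.2) -> u x0 = u' x0 ->
  wsum s u x0 <= wsum s u' x0.
Proof.
move=> su u0; rewrite /wsum big_seq [leRHS]big_seq; apply: ler_sum => q /su[q0 uq].
by rewrite ler_wpM2l // u0 lerD2r.
Qed.

Lemma ler_second_diff (R : realType) (Omega : set (plane R))
    (D : discretisation R) (h0 h : R) (x0 nu : plane R) (u u' : plane R -> R) :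
  grid_hyp Omega D h0 -> 0 < h < h0 -> x0 \in grid D h -> Omega x0 ->
  direction D h nu -> u x0 = u' x0 ->
  (forall y, y \in grid D h -> u y <= u' y) ->
  second_diff D h u x0 nu <= second_diff D h u' x0 nu.
Proof.
move=> HG hh x0G x0O dnu u0 uu'.
have [s [sE sP _ _ _]] := second_diff_stencil HG hh x0G x0O dnu.
rewrite !sE; apply: ler_wsum => // q /sP[q0 qG _ _].
by split => //; exact: uu'.
Qed.

Lemma gnbr_quadrant (R : realType) (Omega : set (plane R))
    (D : discretisation R) (h0 h : R) (x0 e : plane R) :
  grid_hyp Omega D h0 -> 0 < h < h0 -> x0 \in grid D h -> Omega x0 ->
  coord_direction e -> forall j, (1 <= j <= 4)%N ->
  in_quadrant j (coorC x0 e (gnbr D h x0 e j)) (coorS x0 e (gnbr D h x0 e j)).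
Proof.
by move=> HG hh x0G x0O ce j /(grid_gstencil HG hh x0G x0O ce)[[]].
Qed.

Lemma gnbr_grid (R : realType) (Omega : set (plane R))
    (D : discretisation R) (h0 h : R) (x0 e : plane R) :
  grid_hyp Omega D h0 -> 0 < h < h0 -> x0 \in grid D h -> Omega x0 ->
  coord_direction e -> forall j, (1 <= j <= 4)%N ->
  gnbr D h x0 e j \in grid D h.
Proof.
by move=> HG hh x0G x0O ce j /(grid_gstencil HG hh x0G x0O ce)[[]].
Qed.

Lemma slope_ge0 (R : realType) (x : nat -> plane R) (u : plane R -> R)
    (x0 e : plane R) : 0 <= slope x u x0 e.
Proof. by rewrite /slope le_max lexx orbT. Qed.

Lemma ler_slope (R : realType) (Omega : set (plane R))
    (D : discretisation R) (h0 h : R) (x0 e : plane R) (u u' : plane R -> R) :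
  grid_hyp Omega D h0 -> 0 < h < h0 -> x0 \in grid D h -> Omega x0 ->
  coord_direction e -> u x0 = u' x0 ->
  (forall y, y \in grid D h -> u y <= u' y) ->
  slope (gnbr D h x0 e) u' x0 e <= slope (gnbr D h x0 e) u x0 e.
Proof.
move=> HG hh x0G x0O ce u0 uu'.
have [b [b0 bE _ _]] := slope_stencil (gnbr_quadrant HG hh x0G x0O ce).
have gG := gnbr_grid HG hh x0G x0O ce.
rewrite !bE; apply: le_max2; last exact: lexx.
apply: le_max2; rewrite lerN2; apply: ler_wsum => // q;
  rewrite /= !inE => /orP[] /eqP -> /=; by split; [exact: b0|exact/uu'/gG].
Qed.

(** Raising u(x) - u(y) lowers every increment of u, hence lowers every second
    difference and raises every slope, the weights being nonnegative.  Slopes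
    are truncated at 0, so their squares are raised too; with kappa nonnegative
    each of the two terms of the scheme is raised. *)
Lemma monotone_Fh (R : realType) (Omega : set (plane R))
    (g kappa : plane R -> R) (D : discretisation R) (h0 : R) :
  (forall x, Omega x -> 0 <= kappa x) -> grid_hyp Omega D h0 ->
  monotone_scheme (grid D) h0 (Fh Omega g kappa D).
Proof.
move=> kappa0 HG h x hh xG z z' v v' zz' vx vv'; rewrite /Fh.
case: ifPn => [/set_mem xO|_]; last by rewrite lerD2r.
have n0 := grid_nang HG hh.
have sd nu : direction D h nu ->
    second_diff D h (fun y => - v' y) x nu <=
    second_diff D h (fun y => - v y) x nu.
  move=> dnu; apply: (ler_second_diff HG hh xG xO dnu); first by rewrite vx.
  by move=> y /vv'; rewrite lerN2.
apply: le_max2; last first.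
  rewrite lerN2; apply: ler_min_upto; first by rewrite muln_gt0.
  by move=> j jn; apply: sd; exists j.
apply: lerD.
  rewrite lerN2; apply: ler_min_upto => // j jn.
  have max0 (a : R) : 0 <= Num.max a 0 by rewrite le_max lexx orbT.
  apply: ler_pM => //; apply: le_max2 => //; apply: sd.
    exact: direction_unit_dir.
  exact: direction_perp.
have slope_le e : coord_direction e ->
    slope (gnbr D h x e) (fun y => - v y) x e <=
    slope (gnbr D h x e) (fun y => - v' y) x e.
  move=> ce; apply: (ler_slope HG hh xG xO ce); first by rewrite vx.
  by move=> y /vv'; rewrite lerN2.
rewrite ler_wpM2l ?kappa0 // lerXn2r ?nnegrE ?addr_ge0 ?sqr_ge0 //.
rewrite lerD2l; apply: lerD; rewrite lerXn2r ?nnegrE ?slope_ge0 //;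
  apply: slope_le; by [left|right].
Qed.

(** * Local Lipschitz continuity *)

Definition dist_on (R : realType) (X : seq (plane R)) (v v' : plane R -> R) :
  R := \big[Num.max/0]_(y <- X) `|v y - v' y|.

(** These functionals contain the values at the points of X and are closed under
    sums, products, maxima and minima, which is all that the scheme is built
    from. *)
Definition loc_lipschitz (R : realType) (X : seq (plane R))
    (f : (plane R -> R) -> R) : Prop :=
  forall v0, exists r L : R, [/\ 0 < r, 0 <= L &
    forall v v', dist_on X v v0 < r -> dist_on X v' v0 < r ->
      `|f v - f v'| <= L * dist_on X v v'].

Lemma dist_on_ge0 (R : realType) (X : seq (plane R)) (v v' : plane R -> R) :
  0 <= dist_on X v v'.
Proof. exact: bigmax_ge_id. Qed.

Lemma dist_on_refl (R : realType) (X : seq (plane R)) (v : plane R -> R) :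
  dist_on X v v = 0.
Proof.
apply/eqP; rewrite eq_le dist_on_ge0 andbT; apply: bigmax_le => // y _.
by rewrite subrr normr0.
Qed.

Lemma loc_lipschitz_cst (R : realType) (X : seq (plane R)) (c : R) :
  loc_lipschitz X (fun=> c).
Proof.
move=> v0; exists 1, 0; split => // v v' _ _.
by rewrite subrr normr0 mul0r.
Qed.

Lemma loc_lipschitz_eval (R : realType) (X : seq (plane R)) (y : plane R) :
  y \in X -> loc_lipschitz X (fun v => v y).
Proof.
move=> yX v0; exists 1, 1; split => // v v' _ _.
by rewrite mul1r; exact: (@le_bigmax_seq _ _ _ _ _ y).
Qed.

Lemma loc_lipschitz2 (R : realType) (X : seq (plane R)) (op : R -> R -> R)
    (f f' : (plane R -> R) -> R) :
  (forall a b a' b', `|op a b - op a' b'| <= `|a - a'| + `|b - b'|) ->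
  loc_lipschitz X f -> loc_lipschitz X f' ->
  loc_lipschitz X (fun v => op (f v) (f' v)).
Proof.
move=> opL fL f'L v0.
have [r [L [r0 L0 fP]]] := fL v0; have [r' [L' [r'0 L'0 fP']]] := f'L v0.
exists (Num.min r r'), (L + L'); split; rewrite ?addr_ge0 ?lt_min ?r0 //.
move=> v v'; rewrite !lt_min => /andP[vr vr'] /andP[v'r v'r'].
apply: le_trans (opL _ _ _ _) _; rewrite mulrDl lerD ?fP ?fP' //.
Qed.

Lemma loc_lipschitzD (R : realType) (X : seq (plane R))
    (f f' : (plane R -> R) -> R) :
  loc_lipschitz X f -> loc_lipschitz X f' ->
  loc_lipschitz X (fun v => f v + f' v).
Proof.
apply: loc_lipschitz2 => a b a' b'.
by rewrite opprD addrACA ler_normD.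
Qed.

Lemma maxr_lipschitz (R : realType) (a b a' b' : R) :
  `|Num.max a b - Num.max a' b'| <= Num.max `|a - a'| `|b - b'|.
Proof.
have [aa1 aa2] : a - a' <= `|a - a'| /\ a' - a <= `|a - a'|.
  by split; [exact: ler_norm|rewrite distrC; exact: ler_norm].
have [bb1 bb2] : b - b' <= `|b - b'| /\ b' - b <= `|b - b'|.
  by split; [exact: ler_norm|rewrite distrC; exact: ler_norm].
rewrite ler_norml.
apply/andP; split; case: (leP a b) => ?; case: (leP a' b') => ?;
  case: (leP `|a - a'| `|b - b'|) => ?; lra.
Qed.

Lemma loc_lipschitz_max (R : realType) (X : seq (plane R))
    (f f' : (plane R -> R) -> R) :
  loc_lipschitz X f -> loc_lipschitz X f' ->
  loc_lipschitz X (fun v => Num.max (f v) (f' v)).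
Proof.
apply: loc_lipschitz2 => a b a' b'; apply: le_trans (maxr_lipschitz _ _ _ _) _.
by rewrite ge_max lerDl lerDr ?normr_ge0.
Qed.

Lemma loc_lipschitzM (R : realType) (X : seq (plane R))
    (f f' : (plane R -> R) -> R) :
  loc_lipschitz X f -> loc_lipschitz X f' ->
  loc_lipschitz X (fun v => f v * f' v).
Proof.
move=> fL f'L v0.
have [r [L [r0 L0 fP]]] := fL v0; have [r' [L' [r'0 L'0 fP']]] := f'L v0.
pose M := `|f v0| + L * r; pose M' := `|f' v0| + L' * r'.
have M0 : 0 <= M by rewrite addr_ge0 // mulr_ge0 // ltW.
have M'0 : 0 <= M' by rewrite addr_ge0 // mulr_ge0 // ltW.
exists (Num.min r r'), (L * M' + M * L'); split.
- by rewrite lt_min r0.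
- by rewrite addr_ge0 ?mulr_ge0.
move=> v v'; rewrite !lt_min => /andP[vr vr'] /andP[v'r v'r'].
have fM : `|f v'| <= M.
  rewrite -(subrK (f v0) (f v')) (le_trans (ler_normD _ _)) // addrC lerD2l.
  rewrite (le_trans (fP _ _ v'r _)) ?dist_on_refl // ler_wpM2l // ltW //.
have f'M : `|f' v| <= M'.
  rewrite -(subrK (f' v0) (f' v)) (le_trans (ler_normD _ _)) // addrC lerD2l.
  rewrite (le_trans (fP' _ _ vr' _)) ?dist_on_refl // ler_wpM2l // ltW //.
have -> : f v * f' v - f v' * f' v' =
    (f v - f v') * f' v + f v' * (f' v - f' v') by ring.
rewrite (le_trans (ler_normD _ _)) // !normrM mulrDl lerD //.
  by rewrite mulrAC ler_pM // fP.
by rewrite -mulrA ler_pM // fP'.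
Qed.

Lemma loc_lipschitzN (R : realType) (X : seq (plane R))
    (f : (plane R -> R) -> R) :
  loc_lipschitz X f -> loc_lipschitz X (fun v => - f v).
Proof.
move=> fL v0; have [r [L [r0 L0 fP]]] := fL v0; exists r, L; split => //.
by move=> v v' vr v'r; rewrite -opprD normrN fP.
Qed.

Lemma loc_lipschitz_min (R : realType) (X : seq (plane R))
    (f f' : (plane R -> R) -> R) :
  loc_lipschitz X f -> loc_lipschitz X f' ->
  loc_lipschitz X (fun v => Num.min (f v) (f' v)).
Proof.
move=> fL f'L.
rewrite [X in loc_lipschitz _ X](_ : _ =
  fun v => - Num.max (- f v) (- f' v)); last first.
  by apply/funext => v; rewrite -oppr_min opprK.
by apply/loc_lipschitzN/loc_lipschitz_max; exact: loc_lipschitzN.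
Qed.

Lemma loc_lipschitzX (R : realType) (X : seq (plane R))
    (f : (plane R -> R) -> R) (n : nat) :
  loc_lipschitz X f -> loc_lipschitz X (fun v => f v ^+ n).
Proof.
move=> fL; elim: n => [|n IHn]; first exact: loc_lipschitz_cst.
under eq_fun do rewrite exprS; exact: loc_lipschitzM.
Qed.

Lemma loc_lipschitz_min_upto (R : realType) (X : seq (plane R)) (n : nat)
    (f : (plane R -> R) -> nat -> R) :
  (0 < n)%N ->
  (forall j, (1 <= j <= n)%N -> loc_lipschitz X (fun v => f v j)) ->
  loc_lipschitz X (fun v => min_upto n (f v)).
Proof.
move=> n0 fL; rewrite /min_upto.
have : forall j, j \in index_iota 1 n.+1 -> loc_lipschitz X (fun v => f v j).
  by move=> j; rewrite mem_index_iota ltnS; exact: fL.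
elim: (index_iota 1 n.+1) => [_|j s IHs sL].
  by under eq_fun do rewrite big_nil; exact: fL.
under eq_fun do rewrite big_cons.
apply: loc_lipschitz_min; first by apply: sL; rewrite mem_head.
by apply: IHs => i si; apply: sL; rewrite in_cons si orbT.
Qed.

Lemma loc_lipschitz_wsum (R : realType) (X : seq (plane R))
    (s : seq (R * plane R)) (x0 : plane R) :
  x0 \in X -> (forall q, q \in s -> q.2 \in X) ->
  loc_lipschitz X (fun v => wsum s (fun y => - v y) x0).
Proof.
move=> x0X; rewrite /wsum; elim: s => [_|q s IHs sX].
  by under eq_fun do rewrite big_nil; exact: loc_lipschitz_cst.
under eq_fun do rewrite big_cons.
apply: loc_lipschitzD; last first.
  by apply: IHs => p ps; apply: sX; rewrite in_cons ps orbT.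
apply: loc_lipschitzM; first exact: loc_lipschitz_cst.
apply: loc_lipschitzD.
  by apply/loc_lipschitzN/loc_lipschitz_eval/sX; rewrite mem_head.
exact/loc_lipschitzN/loc_lipschitzN/loc_lipschitz_eval.
Qed.

Lemma lipschitz_Fh (R : realType) (Omega : set (plane R))
    (g kappa : plane R -> R) (D : discretisation R) (h0 : R) :
  grid_hyp Omega D h0 -> lipschitz_scheme (grid D) h0 (Fh Omega g kappa D).
Proof.
move=> HG h x hh xG z0 v0; rewrite /Fh /dist_args.
case: (boolP (x \in Omega)) => [/set_mem xO|_]; last first.
  exists 1, 1; split => // z z' v v' _ _.
  by rewrite mul1r opprB addrA subrK le_max lexx.
have n0 := grid_nang HG hh.
have sdL nu : direction D h nu ->
    loc_lipschitz (grid D h) (fun v => second_diff D h (fun y => - v y) x nu).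
  move=> dnu; have [s [sE sP _ _ _]] := second_diff_stencil HG hh xG xO dnu.
  under eq_fun do rewrite sE; apply: loc_lipschitz_wsum => // q.
  by case/sP.
have slL e : coord_direction e ->
    loc_lipschitz (grid D h)
      (fun v => slope (gnbr D h x e) (fun y => - v y) x e).
  move=> ce.
  have [b [b0 bE _ _]] := slope_stencil (gnbr_quadrant HG hh xG xO ce).
  have gG := gnbr_grid HG hh xG xO ce.
  under eq_fun do rewrite bE.
  apply: loc_lipschitz_max; last exact: loc_lipschitz_cst.
  apply: loc_lipschitz_max; apply/loc_lipschitzN/loc_lipschitz_wsum => // q;
    by rewrite /= !inE => /orP[] /eqP ->; exact: gG.
suff FL : loc_lipschitz (grid D h) (fun v =>
    Num.max (- det_h D h (fun y => - v y) x +
             kappa x * (1 + grad_sq D h (fun y => - v y) x) ^+ 2)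
            (- lambda1_h D h (fun y => - v y) x)).
  have [r [L [r0 L0 FP]]] := FL v0; exists r, L; split => // z z' v v'.
  rewrite !gt_max => /andP[_ vr] /andP[_ v'r].
  apply: le_trans (FP _ _ vr v'r) _.
  by rewrite ler_wpM2l // le_max lexx orbT.
apply: loc_lipschitz_max; last first.
  apply/loc_lipschitzN/loc_lipschitz_min_upto; first by rewrite muln_gt0.
  by move=> j jn; apply: sdL; exists j.
apply: loc_lipschitzD.
  apply/loc_lipschitzN/loc_lipschitz_min_upto => // j jn.
  apply: loc_lipschitzM; apply: loc_lipschitz_max;
    do ?[exact: loc_lipschitz_cst]; apply: sdL.
    exact: direction_unit_dir.
  exact: direction_perp.
apply: loc_lipschitzM; first exact: loc_lipschitz_cst.
apply/loc_lipschitzX/loc_lipschitzD; first exact: loc_lipschitz_cst.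
by apply: loc_lipschitzD; apply/loc_lipschitzX/slL; [left|right].
Qed.

(** * Second derivatives and Taylor expansions in the plane *)

Lemma is_derive_line (R : realType) (f : plane R -> R) (z v : plane R)
    (t : R) :
  (forall y, differentiable f y) ->
  is_derive t 1 (fun s : R => f (z + s *: v)) ('D_v f (z + t *: v)).
Proof.
move=> df.
have E : (fun h : R => h^-1 *: (((fun s : R => f (z + s *: v)) \o shift t) (h *: 1)
            - f (z + t *: v))) =
         (fun h : R => h^-1 *: ((f \o shift (z + t *: v)) (h *: v)
            - f (z + t *: v))).
  apply/funext => h /=; congr (_ *: (f _ - _)).
  by rewrite [h *: 1]mulr1 scalerDl addrCA.
have dv : derivable f (z + t *: v) v by exact: diff_derivable.
by split; [rewrite /derivable E|rewrite /derive E].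
Qed.

Lemma derive_coord (R : realType) (f : plane R -> R) (y v : plane R) :
  differentiable f y ->
  'D_v f y = v.1 * partial true f y + v.2 * partial false f y.
Proof.
move=> df; rewrite /partial !deriveE //.
have {1}-> : v = v.1 *: e1 R + v.2 *: e2 R.
  by case: v => a b; rewrite /e1 /e2; congr pair => /=;
    rewrite /GRing.scale /= ?mulr1 ?mulr0 ?addr0 ?add0r.
by rewrite linearD !linearZ.
Qed.

Lemma mvt_everywhere (R : realType) (f df : R -> R) (a b : R) :
  a <= b -> (forall t : R, is_derive t 1 f (df t)) ->
  exists2 c, a <= c <= b & f b - f a = df c * (b - a).
Proof.
move=> ab dfE.
have fc : {within `[a, b], continuous f}.
  apply: continuous_subspaceT => t; apply: differentiable_continuous.
  by apply/derivable1_diffP; case: (dfE t).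
have [c cab E] := MVT_segment ab (fun t _ => dfE t) fc.
by exists c => //; move: cab; rewrite in_itv.
Qed.

Lemma smooth_partial (R : realType) (phi : plane R -> R) (i : bool) :
  smooth phi -> smooth (partial i phi).
Proof. by move=> sphi s x; have := sphi (rcons s i) x; rewrite foldr_rcons. Qed.

Lemma smooth_differentiable (R : realType) (phi : plane R -> R) :
  smooth phi -> forall x, differentiable phi x.
Proof. by move=> sphi; exact: (sphi [::]). Qed.

Lemma smooth_near (R : realType) (f : plane R -> R) (x : plane R) (eps : R) :
  smooth f -> 0 < eps -> \forall y \near x, `|f y - f x| < eps.
Proof.
move=> sf eps0.
have /cvgr_dist_lt/(_ _ eps0) : f y @[y --> x] --> f x.
  exact/differentiable_continuous/smooth_differentiable.
by apply: filterS => y; rewrite distrC.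
Qed.

Lemma near_norm (R : realType) (P : plane R -> Prop) (x : plane R) :
  (\forall y \near x, P y) ->
  exists2 d : R, 0 < d & forall y, `|y - x| < d -> P y.
Proof.
move=> /nbhs_ballP[d /= d0 dP]; exists d => // y yx; apply: dP.
by rewrite -ball_normE /= distrC.
Qed.

(** The mixed second difference does not distinguish the two coordinates, while
    two applications of the mean value theorem, in either order, turn it into a
    mixed derivative at a nearby point. *)
Lemma second_difference_mvt (R : realType) (phi : plane R -> R) (x : plane R)
    (i : bool) (s : R) : smooth phi -> 0 < s ->
  let a := if i then e1 R else e2 R in
  let b := if i then e2 R else e1 R in
  exists2 y, `|y - x| <= s &
   phi (x + s *: a + s *: b) - phi (x + s *: a) - phi (x + s *: b) + phi x =
   partial (~~ i) (partial i phi) y * s ^+ 2.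
Proof.
move=> sphi s0 a b.
have dphi := smooth_differentiable sphi.
have dpphi := smooth_differentiable (smooth_partial i sphi).
pose F t := phi (x + s *: b + t *: a) - phi (x + t *: a).
have [t /andP[t0 ts]] := @mvt_everywhere R F
  (fun t => partial i phi (x + s *: b + t *: a) - partial i phi (x + t *: a))
  0 s (ltW s0) (fun t => is_deriveB (is_derive_line _ _ _ dphi)
                                    (is_derive_line _ _ _ dphi)).
rewrite subr0 /F !scale0r !addr0 => E1.
pose G r := partial i phi (x + t *: a + r *: b).
have [r /andP[r0 rs]] := @mvt_everywhere R G
  (fun r => 'D_b (partial i phi) (x + t *: a + r *: b))
  0 s (ltW s0) (fun r => is_derive_line _ _ _ dpphi).
rewrite subr0 /G !scale0r !addr0 => E2.
exists (x + t *: a + r *: b).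
  have -> : x + t *: a + r *: b - x = if i then (t, r) else (r, t).
    by rewrite /a /b [LHS]surjective_pairing; case: (i); congr pair;
      rewrite /= /GRing.scale /=; ring.
  by case: (i); rewrite ge_max /= ger0_norm // ger0_norm // ts rs.
rewrite expr2 mulrA (_ : partial _ _ _ = 'D_b (partial i phi) (x + t *: a + r *: b)).
  rewrite -E2 (addrAC x (t *: a)) -E1 (addrAC x (s *: b)); ring.
by rewrite /b /partial; case: (i).
Qed.

(** Schwarz's theorem: at scale d both mixed derivatives, taken at suitable
    nearby points, equal the same difference quotient, and both are
    continuous. *)
Lemma partial_sym (R : realType) (phi : plane R -> R) (x : plane R) :
  smooth phi ->
  partial false (partial true phi) x = partial true (partial false phi) x.
Proof.
move=> sphi; apply/eqP; rewrite -subr_eq0 -normr_le0; apply/ler_addgt0Pl => e e0.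
rewrite addr0.
have e20 : 0 < e / 2 by rewrite divr_gt0.
have s1 := smooth_partial false (smooth_partial true sphi).
have s2 := smooth_partial true (smooth_partial false sphi).
have [d d0 dP] := near_norm (filterI (smooth_near x s1 e20)
                                     (smooth_near x s2 e20)).
have s0 : 0 < d / 2 by rewrite divr_gt0.
have [y1 y1s E1] := second_difference_mvt x true sphi s0.
have [y2 y2s E2] := second_difference_mvt x false sphi s0.
have dd : d / 2 < d by rewrite ltr_pdivrMr // ltr_pMr // ltr1n.
have [+ _] := dP _ (le_lt_trans y1s dd); have [_ +] := dP _ (le_lt_trans y2s dd).
have -> : partial true (partial false phi) y2 = partial false (partial true phi) y1.
  apply: (@mulIf _ ((d / 2) ^+ 2)); first by rewrite gt_eqF // exprn_gt0.
  rewrite -E1 -E2 /= (addrAC x) -!addrA; congr (_ + _).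
  by rewrite addrCA.
move: (partial false _ y1) (partial true _ x) (partial false _ x) => A B C.
rewrite !ltr_norml ler_norml => /andP[? ?] /andP[? ?].
by apply/andP; split; lra.
Qed.

Definition quad (R : realType) (X : 'M[R]_2) (v : plane R) : R :=
  X 0 0 * v.1 ^+ 2 + (X 0 1 + X 1 0) * (v.1 * v.2) + X 1 1 * v.2 ^+ 2.

Lemma plane_norm_lt (R : realType) (v : plane R) (r : R) :
  (`|v| < r) = (`|v.1| < r) && (`|v.2| < r).
Proof. by rewrite [`|v|]/Num.norm /= gt_max. Qed.

Lemma segment_near (R : realType) (x z v : plane R) (r t : R) :
  0 <= t <= 1 -> `|z - x| < r / 2 -> `|v| < r / 2 -> `|z + t *: v - x| < r.
Proof.
move=> /andP[t0 t1] zx vr; rewrite addrAC (le_lt_trans (ler_normD _ _)) //.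
rewrite [ltRHS]splitr ltrD // (le_lt_trans _ vr) // normrZ ger0_norm //.
by rewrite ler_piMl.
Qed.

(** The gradient is evaluated at the fixed point x while the base point z varies;
    this locally uniform form is what the double limit in the scheme needs. *)
Lemma taylor1 (R : realType) (phi : plane R -> R) (x : plane R) (eps : R) :
  smooth phi -> 0 < eps -> exists2 r : R, 0 < r &
  forall z v, `|z - x| < r -> `|v| < r ->
    `|phi (z + v) - phi z - dot (grad phi x) v| <= eps * (`|v.1| + `|v.2|).
Proof.
move=> sphi eps0.
have [d d0 dP] := near_norm (filterI
  (smooth_near x (smooth_partial true sphi) eps0)
  (smooth_near x (smooth_partial false sphi) eps0)).
exists (d / 2); first by rewrite divr_gt0.
move=> z v zx vd; have dphi := smooth_differentiable sphi.
have [t t01] := @mvt_everywhere R (fun t => phi (z + t *: v)) _ 0 1 ler01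
  (fun t => is_derive_line _ _ _ dphi).
rewrite scale1r scale0r addr0 subr0 mulr1 derive_coord // => ->.
have [+ +] := dP _ (segment_near t01 zx vd); rewrite /dot /grad /=.
move: (partial true _ _) (partial false _ _) (partial true _ _)
  (partial false _ _) => a' b' a b aa' bb'.
rewrite (_ : _ - _ = (a - a') * v.1 + (b - b') * v.2); last by ring.
rewrite (le_trans (ler_normD _ _)) // !normrM mulrDr lerD //.
  by rewrite ler_wpM2r // ltW.
by rewrite ler_wpM2r // ltW.
Qed.

(** |xy| is at most half of x^2 + y^2. *)
Lemma quad_small (R : realType) (a b c d x y eps : R) :
  0 <= eps -> `|a| <= eps -> `|b| <= eps -> `|c| <= eps -> `|d| <= eps ->
  `|a * x ^+ 2 + (b + c) * (x * y) + d * y ^+ 2| <=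
  2 * eps * (x * x + y * y).
Proof.
move=> e0; rewrite 4!ler_norml => /andP[? ?] /andP[? ?] /andP[? ?] /andP[? ?].
have xy : `|x * y| <= (x * x + y * y) / 2.
  have := sqr_ge0 (x + y); have := sqr_ge0 (x - y); rewrite !expr2 => ? ?.
  by rewrite ler_norml; apply/andP; split; lra.
have H1 : `|a * x ^+ 2| <= eps * x ^+ 2.
  by rewrite normrM [`|x ^+ 2|]ger0_norm ?sqr_ge0 // ler_wpM2r ?sqr_ge0 //
    ler_norml; apply/andP; split; lra.
have H2 : `|d * y ^+ 2| <= eps * y ^+ 2.
  by rewrite normrM [`|y ^+ 2|]ger0_norm ?sqr_ge0 // ler_wpM2r ?sqr_ge0 //
    ler_norml; apply/andP; split; lra.
have H3 : `|(b + c) * (x * y)| <= 2 * eps * ((x * x + y * y) / 2).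
  by rewrite normrM ler_pM // ler_norml; apply/andP; split; lra.
rewrite (le_trans (ler_normD _ _)) // (le_trans (lerD (ler_normD _ _) H2)) //.
by lra.
Qed.

(** The Hessian is taken at the fixed point x and the gradient at z.  Along the
    segment from z to z + v the error and its derivative vanish at 0, and its
    second derivative is the quadratic form of D^2 phi - D^2 phi(x); two mean
    value steps bound the error. *)
Lemma taylor2 (R : realType) (phi : plane R -> R) (x : plane R) (eps : R) :
  smooth phi -> 0 < eps -> exists2 r : R, 0 < r &
  forall z v, `|z - x| < r -> `|v| < r ->
    `|phi (z + v) - phi z - dot (grad phi z) v - quad (hess phi x) v / 2|
      <= eps * dot v v.
Proof.
move=> sphi eps0; have e20 : 0 < eps / 2 by rewrite divr_gt0.
pose sp i j := smooth_partial i (smooth_partial j sphi).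
have [d d0 dP] := near_norm (filterI
  (filterI (smooth_near x (sp true true) e20) (smooth_near x (sp true false) e20))
  (filterI (smooth_near x (sp false true) e20) (smooth_near x (sp false false) e20))).
exists (d / 2); first by rewrite divr_gt0.
move=> z v zx vd; have dphi := smooth_differentiable sphi.
have dpphi i := smooth_differentiable (smooth_partial i sphi).
set q := quad _ v; set gz := dot _ v.
pose F t := phi (z + t *: v) - (t * gz + t ^+ 2 * (q / 2)).
pose G t := v.1 * partial true phi (z + t *: v) +
  v.2 * partial false phi (z + t *: v) - (gz + t * q).
have dF (t : R) : is_derive t 1 F (G t).
  apply: is_derive_eq.
    apply: is_deriveB; first exact: is_derive_line.
  rewrite /G derive_coord //; congr (_ - _).
  by rewrite /GRing.scale /=; field.
have dG (t : R) : is_derive t 1 G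
    (v.1 * 'D_v (partial true phi) (z + t *: v) +
     v.2 * 'D_v (partial false phi) (z + t *: v) - q).
  apply: is_derive_eq.
    apply: is_deriveB; apply: is_deriveD; apply: is_deriveM;
      exact: is_derive_line.
  move: ('D_v (partial true _) _) ('D_v (partial false _) _) => a b.
  rewrite /GRing.scale /=.
  move: (partial true _ _) (partial false _ _) => a' b'.
  clearbody q gz.
  by ring.
have [c /[dup] c01 /andP[c0 c1]] := mvt_everywhere ler01 dF.
rewrite {1 2}/F scale1r scale0r addr0 expr1n !mul1r expr0n !mul0r addr0 !subr0 mulr1.
move=> E1.
have [b /andP[b0 bc]] := mvt_everywhere c0 dG.
rewrite {2}/G scale0r addr0 mul0r addr0 subr0 => E2.
have E3 : v.1 * partial true phi z + v.2 * partial false phi z - gz = 0.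
  by rewrite /gz /dot /grad /=; ring.
rewrite E3 subr0 in E2.
rewrite (_ : _ - q / 2 = G c); last by rewrite -E1; ring.
rewrite E2 normrM (ger0_norm c0) (le_trans (ler_piMr _ c1)) //.
have b01 : 0 <= b <= 1 by rewrite b0 (le_trans bc).
have [[/ltW D11 /ltW D12] [/ltW D21 /ltW D22]] := dP _ (segment_near b01 zx vd).
have := quad_small v.1 v.2 (ltW e20) D11 D21 D12 D22.
rewrite [2 * _]mulrC divfK //.
rewrite (derive_coord _ (dpphi true _)) (derive_coord _ (dpphi false _)).
rewrite /q /quad !mxE /= /dot; move: (z + b *: v) => y.
move: (partial true (partial true phi) y) (partial true (partial false phi) y)
  (partial false (partial true phi) y) (partial false (partial false phi) y)
  (partial true (partial true phi) x) (partial true (partial false phi) x)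
  (partial false (partial true phi) x) (partial false (partial false phi) x).
clear; move: v.1 v.2 => v1 v2 a1 a2 a3 a4 b1 b2 b3 b4.
set E1 := (X in `|X| <= _ -> _); set E2 := (X in _ -> `|X| <= _).
rewrite (_ : E1 = E2) // /E1 /E2; ring.
Qed.

(** * Eigenvalues of a symmetric 2 x 2 matrix as extrema of its quadratic form *)

Lemma eigenvalue2 (R : realType) (X : 'M[R]_2) (a : R) :
  eigenvalue X a = ((a - X 0 0) * (a - X 1 1) == X 0 1 * X 1 0).
Proof.
rewrite eigenvalue_root_char /root /char_poly (expand_det_row _ 0).
rewrite !big_ord_recl big_ord0 addr0 /cofactor !det_mx11 !mxE /=.
rewrite (_ : lift 0 0 = 1 :> 'I_2); last exact/val_inj.
rewrite (_ : lift 1 0 = 0 :> 'I_2); last exact/val_inj.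
rewrite expr0 expr1 !mulr1n !mulr0n !hornerE /= -[RHS]subr_eq0; congr (_ == _).
ring.
Qed.

Definition eig_mean (R : realType) (X : 'M[R]_2) : R := (X 0 0 + X 1 1) / 2.
(** For symmetric X the eigenvalues are eig_mean X - eig_gap X and
    eig_mean X + eig_gap X. *)
Definition eig_gap (R : realType) (X : 'M[R]_2) : R :=
  Num.sqrt (((X 0 0 - X 1 1) / 2) ^+ 2 + X 0 1 ^+ 2).

Lemma eig_gap_ge0 (R : realType) (X : 'M[R]_2) : 0 <= eig_gap X.
Proof. exact: sqrtr_ge0. Qed.

Lemma eig_gap_sqr (R : realType) (X : 'M[R]_2) :
  eig_gap X ^+ 2 = ((X 0 0 - X 1 1) / 2) ^+ 2 + X 0 1 ^+ 2.
Proof. by rewrite sqr_sqrtr // addr_ge0 ?sqr_ge0. Qed.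

Lemma eigenvalue_sym (R : realType) (X : 'M[R]_2) :
  X 1 0 = X 0 1 ->
  [set a | eigenvalue X a] =
  [set eig_mean X - eig_gap X; eig_mean X + eig_gap X].
Proof.
move=> symX; apply/seteqP; split => a /=; rewrite eigenvalue2 symX -subr_eq0.
  have -> : (a - X 0 0) * (a - X 1 1) - X 0 1 * X 0 1 =
      (a - (eig_mean X - eig_gap X)) * (a - (eig_mean X + eig_gap X)).
    have := eig_gap_sqr X; rewrite /eig_mean; move: (eig_gap X) => r E.
    transitivity ((a - (X 0 0 + X 1 1) / 2) ^+ 2 - r ^+ 2); last by field.
    by rewrite E; field.
  by rewrite mulf_eq0 !subr_eq0 => /orP[] /eqP; [left|right].
have -> : (a - X 0 0) * (a - X 1 1) - X 0 1 * X 0 1 =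
    (a - eig_mean X) ^+ 2 - eig_gap X ^+ 2.
  by rewrite eig_gap_sqr /eig_mean; field.
by case=> ->; apply/eqP; ring.
Qed.

Lemma lambda1E (R : realType) (X : 'M[R]_2) :
  X 1 0 = X 0 1 -> lambda1 X = eig_mean X - eig_gap X.
Proof.
move=> symX; rewrite /lambda1 eigenvalue_sym //; apply/eqP; rewrite eq_le.
have lbX : lbound [set eig_mean X - eig_gap X; eig_mean X + eig_gap X]
    (eig_mean X - eig_gap X).
  by move=> _ [] ->; rewrite ?lexx // lerD2l (le_trans _ (eig_gap_ge0 X)) //
    oppr_le0 eig_gap_ge0.
apply/andP; split.
  by apply: ge_inf; [exists (eig_mean X - eig_gap X)|left].
by apply: lb_le_inf => //; exists (eig_mean X - eig_gap X); left.
Qed.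

Lemma lambda2E (R : realType) (X : 'M[R]_2) :
  X 1 0 = X 0 1 -> lambda2 X = eig_mean X + eig_gap X.
Proof.
move=> symX; rewrite /lambda2 eigenvalue_sym //; apply/eqP; rewrite eq_le.
have ubX : ubound [set eig_mean X - eig_gap X; eig_mean X + eig_gap X]
    (eig_mean X + eig_gap X).
  by move=> _ [] ->; rewrite ?lexx // lerD2l (le_trans _ (eig_gap_ge0 X)) //
    oppr_le0 eig_gap_ge0.
apply/andP; split.
  by apply: ge_sup => //; exists (eig_mean X - eig_gap X); left.
by apply: ub_le_sup; [exists (eig_mean X + eig_gap X)|right].
Qed.

Lemma quad_perp (R : realType) (X : 'M[R]_2) (nu : plane R) :
  dot nu nu = 1 -> quad X nu + quad X (perp nu) = 2 * eig_mean X.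
Proof.
move=> nu1; rewrite /quad /eig_mean /perp /=.
transitivity ((X 0 0 + X 1 1) * dot nu nu); first by rewrite /dot; ring.
by rewrite nu1; field.
Qed.

(** With p half the difference of the diagonal entries and b the off-diagonal
    one, the quadratic form at a unit vector differs from eig_mean by the scalar
    product of (p, b) with another unit vector, and eig_gap is the length of
    (p, b). *)
Lemma lambda1_le_quad (R : realType) (X : 'M[R]_2) (nu : plane R) :
  X 1 0 = X 0 1 -> dot nu nu = 1 -> lambda1 X <= quad X nu.
Proof.
move=> symX nu1; rewrite lambda1E // lerBlDr -lerBlDl.
rewrite (le_trans (ler_norm _)) // -(ler_pXn2r (n := 2)) ?nnegrE ?eig_gap_ge0 //.
rewrite eig_gap_sqr real_normK ?num_real // -subr_ge0 /eig_mean /quad symX.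
pose p := (X 0 0 - X 1 1) / 2.
have -> : (p ^+ 2 + X 0 1 ^+ 2) = (p ^+ 2 + X 0 1 ^+ 2) * dot nu nu ^+ 2.
  by rewrite nu1 expr1n mulr1.
have -> : (X 0 0 + X 1 1) / 2 = (X 0 0 + X 1 1) / 2 * dot nu nu.
  by rewrite nu1 mulr1.
rewrite (_ : _ - _ = (X 0 1 * (nu.1 ^+ 2 - nu.2 ^+ 2) - p * (2 * nu.1 * nu.2)) ^+ 2).
  exact: sqr_ge0.
by rewrite /dot /p; field.
Qed.

(** The quadratic form in direction t/2 is eig_mean + p cos t + b sin t, so the
    minimum is reached where (cos t, sin t) is opposite to (p, b). *)
Lemma lambda1_attained (R : realType) (X : 'M[R]_2) :
  X 1 0 = X 0 1 ->
  exists2 t : R, 0 <= t <= pi & quad X (unit_dir t) = lambda1 X.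
Proof.
move=> symX; rewrite lambda1E //.
pose p := (X 0 0 - X 1 1) / 2; pose r := eig_gap X.
have r2 : r ^+ 2 = p ^+ 2 + X 0 1 ^+ 2 by exact: eig_gap_sqr.
have r0 : 0 <= r := eig_gap_ge0 X.
have quadE t : quad X (unit_dir (t / 2)) =
    eig_mean X + (p * cos t + X 0 1 * sin t).
  have -> : cos t = 2 * cos (t / 2) ^+ 2 - 1.
    by rewrite {1}(splitr t) -mulr2n cos_mulr2n mulr_natl.
  have -> : sin t = 2 * (cos (t / 2) * sin (t / 2)).
    by rewrite {1}(splitr t) -mulr2n sin_mulr2n mulr_natl.
  by rewrite /quad /= sin2cos2 /eig_mean /p symX; field.
have [r_eq0|r_neq0] := eqVneq r 0.
  have /eqP : p ^+ 2 + X 0 1 ^+ 2 = 0 by rewrite -r2 r_eq0 expr0n.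
  rewrite paddr_eq0 ?sqr_ge0 // !sqrf_eq0 => /andP[/eqP p0 /eqP b0].
  exists ((0 : R) / 2); first by rewrite mul0r lexx pi_ge0.
  by rewrite quadE p0 b0 -/r r_eq0 !mul0r !addr0 subr0.
have rp : 0 < r by rewrite lt_neqAle eq_sym r_neq0.
have pr : -1 <= - p / r <= 1.
  rewrite -ler_norml normrM normrN normfV (ger0_norm r0) ler_pdivrMr // mul1r.
  rewrite -(ler_pXn2r (n := 2)) ?nnegrE // real_normK ?num_real // r2.
  by rewrite lerDl sqr_ge0.
have ca : cos (acos (- p / r)) = - p / r by rewrite acosK // in_itv.
have sa : sin (acos (- p / r)) = `|X 0 1| / r.
  rewrite sin_acos // (_ : 1 - _ = (X 0 1 / r) ^+ 2).
    by rewrite sqrtr_sqr normrM normfV (ger0_norm r0).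
  by rewrite !expr_div_n sqrrN r2; field; rewrite -r2 expf_neq0.
have [a0 api] := (acos_ge0 pr, acos_lepi pr).
have rE : - r = (p * (- p) - X 0 1 ^+ 2) / r.
  apply: (mulIf r_neq0); rewrite divfK // mulNr -expr2 r2; ring.
have [b0|b0] := leP (X 0 1) 0.
  exists (acos (- p / r) / 2); first by apply/andP; split; lra.
  by rewrite quadE ca sa ler0_norm // -/r rE; congr (_ + _); field.
(* acos only reaches sin >= 0; for b > 0 the reflected angle is needed. *)
exists ((2 * pi - acos (- p / r)) / 2); first by apply/andP; split; lra.
rewrite quadE cosB sinB mulr_natl cos2pi sin2pi ca sa gtr0_norm // -/r rE.
by congr (_ + _); field.
Qed.

(** The eigendirection for lambda1 lies in the upper half plane; if it is not in
    the first quadrant, its rotation by -pi/2 is, and the pair of orthogonal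
    directions is the same up to order. *)
Lemma detp_attained (R : realType) (X : 'M[R]_2) :
  X 1 0 = X 0 1 ->
  exists2 t : R, 0 <= t <= pi / 2 &
  Num.max (quad X (unit_dir t)) 0 * Num.max (quad X (perp (unit_dir t))) 0 =
  detp X.
Proof.
move=> symX; have [t /andP[t0 tpi] tE] := lambda1_attained symX.
have sumE s : quad X (unit_dir s) + quad X (perp (unit_dir s)) =
    lambda1 X + lambda2 X.
  by rewrite quad_perp ?dot_unit_dir // lambda1E // lambda2E //; ring.
have [tp|tp] := leP t (pi / 2).
  exists t; first by rewrite t0.
  rewrite /detp -tE; congr (_ * Num.max _ _).
  by apply: (addrI (quad X (unit_dir t))); rewrite sumE tE.
exists (t - pi / 2); first by apply/andP; split; lra.
have pE : quad X (perp (unit_dir (t - pi / 2))) = lambda1 X.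
  by rewrite perp_unit_dir subrK.
rewrite /detp mulrC pE; congr (_ * Num.max _ _).
by apply: (addIr (lambda1 X)); rewrite -[in LHS]pE sumE addrC.
Qed.

(** When lambda1 is positive, the values p, q of the form at orthogonal
    directions have the sum of the eigenvalues and lie between them, and among
    such pairs the eigenvalues have the smallest product.  Otherwise det^+ is
    0. *)
Lemma detp_le (R : realType) (X : 'M[R]_2) (nu : plane R) :
  X 1 0 = X 0 1 -> dot nu nu = 1 ->
  detp X <= Num.max (quad X nu) 0 * Num.max (quad X (perp nu)) 0.
Proof.
move=> symX nu1; have pnu1 : dot (perp nu) (perp nu) = 1.
  by rewrite -nu1 /dot /perp /=; ring.
have sumE : quad X nu + quad X (perp nu) = lambda1 X + lambda2 X.
  by rewrite quad_perp // lambda1E // lambda2E //; ring.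
have l1 := lambda1_le_quad symX nu1; have l2 := lambda1_le_quad symX pnu1.
have max0 (a : R) : 0 <= Num.max a 0 by rewrite le_max lexx orbT.
have [l0|l0] := leP (lambda1 X) 0.
  by rewrite /detp max_r // mul0r mulr_ge0.
rewrite /detp !max_l ?(le_trans (ltW l0)) //; first by nra.
by rewrite lambda1E // lambda2E // lerD2l (le_trans _ (eig_gap_ge0 X)) //
  oppr_le0 eig_gap_ge0.
Qed.

Lemma cover_angles (R : realType) (n : nat) (d t : R) :
  (0 < n)%N -> 0 <= t <= n%:R * d ->
  exists2 j, (1 <= j <= n)%N & `|j%:R * d - t| <= d.
Proof.
elim: n => // n IHn _ /andP[t0 tn].
have [n0|n0] := posnP n.
  exists 1%N; first by rewrite n0.
  rewrite n0 mul1r in tn *; rewrite ger0_norm ?subr_ge0 //.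
  by rewrite gerBl.
have [tn'|tn'] := leP t (n%:R * d).
  have [|j /andP[j1 jn] jt] := IHn n0; first by rewrite t0.
  by exists j => //; rewrite j1 (leq_trans jn).
exists n.+1; first by rewrite leqnn.
rewrite ger0_norm ?subr_ge0 // -natr1 mulrDl mul1r.
by rewrite lerBlDr addrC lerD2l ltW.
Qed.

Lemma lipschitz_of_derive (R : realType) (f df : R -> R) :
  (forall t : R, is_derive t 1 f (df t)) -> (forall t, `|df t| <= 1) ->
  forall a b, `|f a - f b| <= `|a - b|.
Proof.
move=> fE df1 a b; wlog ab : a b / b <= a.
  by move=> H; have [/H|/ltW/H //] := leP b a; rewrite distrC (distrC a).
have [c _ ->] := mvt_everywhere ab fE.
by rewrite normrM ler_piMl.
Qed.

(** Bounds the quadratic form on unit vectors. *)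
Definition mx_size (R : realType) (X : 'M[R]_2) : R :=
  `|X 0 0| + `|X 0 1 + X 1 0| + `|X 1 1|.

Lemma quad_le_size (R : realType) (X : 'M[R]_2) (nu : plane R) :
  dot nu nu = 1 -> `|quad X nu| <= mx_size X.
Proof.
rewrite /dot -!expr2 => nu1.
have [x0 y0] := (sqr_ge0 nu.1, sqr_ge0 nu.2).
have xy : `|nu.1 * nu.2| <= 1.
  have := sqr_ge0 (nu.1 + nu.2); have := sqr_ge0 (nu.1 - nu.2).
  move=> ? ?.
  by rewrite ler_norml; apply/andP; split; lra.
have norm3 (a b c : R) : `|a + b + c| <= `|a| + `|b| + `|c|.
  by rewrite (le_trans (ler_normD _ _)) // lerD2r ler_normD.
rewrite /quad (le_trans (norm3 _ _ _)) // !lerD // normrM ler_piMr //.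
  by rewrite ger0_norm //; lra.
by rewrite ger0_norm //; lra.
Qed.

Lemma quad_lipschitz (R : realType) (X : 'M[R]_2) (s t : R) :
  `|quad X (unit_dir s) - quad X (unit_dir t)| <= 2 * mx_size X * `|s - t|.
Proof.
have cl : `|cos s - cos t| <= `|s - t|.
  apply: (@lipschitz_of_derive _ _ (fun x => - sin x)) => x.
  by rewrite normrN sin_max.
have sl : `|sin s - sin t| <= `|s - t|.
  exact: (@lipschitz_of_derive _ _ (@cos R)) (@cos_max R) _ _.
have prod_lip (a b a' b' : R) : `|a| <= 1 -> `|b'| <= 1 ->
    `|a - a'| <= `|s - t| -> `|b - b'| <= `|s - t| ->
    `|a * b - a' * b'| <= 2 * `|s - t|.
  move=> a1 b'1 aa' bb'.
  rewrite (_ : _ - _ = a * (b - b') + (a - a') * b'); last by ring.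
  rewrite (le_trans (ler_normD _ _)) // !normrM mulr_natl mulr2n lerD //.
    by rewrite (le_trans (ler_piMl _ a1)).
  by rewrite (le_trans (ler_piMr _ b'1)).
rewrite /quad /= !expr2.
rewrite (_ : _ - _ = X 0 0 * (cos s * cos s - cos t * cos t) +
  (X 0 1 + X 1 0) * (cos s * sin s - cos t * sin t) +
  X 1 1 * (sin s * sin s - sin t * sin t)); last by ring.
rewrite (_ : 2 * _ * _ = mx_size X * (2 * `|s - t|)); last by ring.
rewrite /mx_size [leRHS]mulrDl [X in _ <= X + _]mulrDl.
have norm3 (a b c : R) : `|a + b + c| <= `|a| + `|b| + `|c|.
  by rewrite (le_trans (ler_normD _ _)) // lerD2r ler_normD.
rewrite (le_trans (norm3 _ _ _)) // !lerD // normrM ler_wpM2l //;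
  by rewrite prod_lip ?cos_max ?sin_max.
Qed.

(** * The angular resolution and the stencil radius tend to zero *)

Lemma sin_norm_le (R : realType) (t : R) : `|sin t| <= `|t|.
Proof.
have := @lipschitz_of_derive R (@sin R) (@cos R) _ (@cos_max R) t 0.
by rewrite sin0 !subr0; apply.
Qed.

Lemma cos_ge1B (R : realType) (t : R) : 1 - `|t| <= cos t.
Proof.
have dcos (s : R) : is_derive s 1 (@cos R) (- sin s) by exact: is_derive_cos.
have sin1 (s : R) : `|- sin s| <= 1 by rewrite normrN sin_max.
have := lipschitz_of_derive dcos sin1 t 0; rewrite cos0 subr0 ler_norml.
by move=> /andP[+ _]; lra.
Qed.

Lemma sin_ge_half (R : realType) (t : R) : 0 <= t <= 2^-1 -> t / 2 <= sin t.
Proof.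
move=> /andP[t0 t1].
have dsin (s : R) : is_derive s 1 (@sin R) (cos s) by exact: is_derive_sin.
have [c /andP[c0 ct]] := mvt_everywhere t0 dsin.
rewrite sin0 !subr0 => ->; rewrite mulrC ler_wpM2r //.
by have := cos_ge1B c; rewrite ger0_norm //; lra.
Qed.

Lemma cvg_dtheta (R : realType) (Omega : set (plane R))
    (D : discretisation R) (h0 : R) :
  grid_hyp Omega D h0 -> dtheta D h @[h --> 0^'+] --> (0 : R).
Proof.
move=> HG.
have c4 : h `^ 4^-1 @[h --> (0 : R)^'+] --> (0 : R) by apply: powR_cvg0.
have : (dtheta D h / (2 * pi * h `^ 4^-1)) * ((2 * pi) * h `^ 4^-1)
    @[h --> 0^'+] --> (1 : R) * (2 * pi * 0).
  by apply: cvgM; [exact: grid_dtheta HG|apply: cvgM => //; exact: cvg_cst].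
rewrite mul1r mulr0; apply: cvg_trans; apply: near_eq_cvg.
near=> h; rewrite divfK // mulf_neq0 //.
  by rewrite mulf_neq0 // gt_eqF // pi_gt0.
by rewrite gt_eqF // powR_gt0.
Unshelve. all: by end_near. Qed.

(** The radius is h (1 + cos t cot t + sin t) with t = dtheta / 2 of order
    h^(1/4).  Since sin t is at least t / 2, the radius is at most
    2 h + 4 h^(3/4) for small h. *)
Lemma delta_near (R : realType) (Omega : set (plane R))
    (D : discretisation R) (h0 r : R) :
  grid_hyp Omega D h0 -> 0 < r -> \forall h \near 0^'+, delta D h < r.
Proof.
move=> HG r0.
have d1 : \forall h \near 0^'+, `|dtheta D h| < 1.
  have /cvgr0Pnorm_lt := cvg_dtheta HG; exact.
have rat : \forall h \near 0^'+,
    `|1 - dtheta D h / (2 * pi * h `^ 4^-1)| < 2^-1.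
  by have /cvgrPdist_lt := grid_dtheta HG; apply; rewrite invr_gt0.
have small : \forall h \near (0 : R)^'+, `|2 * h + 4 * h `^ (3 / 4)| < r.
  have : 2 * h + 4 * h `^ (3 / 4) @[h --> (0 : R)^'+] --> (2 * 0 + 4 * 0 : R).
    apply: cvgD; apply: cvgM; do ?exact: cvg_cst.
      exact: cvg_at_right_filter.
    by apply: powR_cvg0; rewrite divr_gt0.
  by rewrite !mulr0 addr0 => /cvgr0Pnorm_lt; exact.
near=> h.
have h_gt0 : 0 < h by near: h; exact: nbhs_right_gt.
have p_gt0 : 0 < h `^ 4^-1 by rewrite powR_gt0.
have d_ge : h `^ 4^-1 <= dtheta D h.
  have : `|1 - dtheta D h / (2 * pi * h `^ 4^-1)| < 2^-1 by near: h.
  rewrite ltr_norml => /andP[_]; rewrite ltrBlDr -ltrBlDl => rh.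
  have pp : 0 < 2 * pi * h `^ 4^-1 by rewrite !mulr_gt0 // pi_gt0.
  have : 2^-1 < dtheta D h / (2 * pi * h `^ 4^-1) by lra.
  rewrite ltr_pdivlMr // => /ltW; apply: le_trans.
  by rewrite -mulrA mulKf // ler_peMl ?ltW // (lt_le_trans _ (pi_ge2 _)) // ltr1n.
have d_gt0 : 0 < dtheta D h := lt_le_trans p_gt0 d_ge.
have d_lt1 : dtheta D h < 1.
  by rewrite -(ger0_norm (ltW d_gt0)); near: h.
rewrite /delta; set t := dtheta D h / 2.
have t0 : 0 < t by rewrite divr_gt0.
have st : h `^ 4^-1 / 4 <= sin t.
  apply: le_trans (sin_ge_half _); rewrite /t; last by apply/andP; split; lra.
  by lra.
have st0 : 0 < sin t by rewrite (lt_le_trans _ st) // divr_gt0.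
have hE : h = h `^ (3 / 4) * h `^ 4^-1.
  by rewrite -powRD ?gt_eqF ?implybT // (_ : 3 / 4 + 4^-1 = 1) ?powRr1 ?ltW //; field.
have hs : h / sin t <= 4 * h `^ (3 / 4).
  rewrite ler_pdivrMr // {1}hE.
  have := ler_wpM2l (powR_ge0 h (3 / 4)) st; lra.
have : 2 * h + 4 * h `^ (3 / 4) < r.
  by rewrite (le_lt_trans (ler_norm _)) //; near: h.
apply: le_lt_trans; rewrite !mulrDr mulr1.
have hc : h * (cos t * (cos t / sin t)) <= h / sin t.
  by rewrite ler_wpM2l ?(ltW h_gt0) // mulrA -expr2 ler_piMl ?invr_ge0 ?(ltW st0) //.
have hsin : h * sin t <= h by rewrite ler_piMr ?sin_le1 // ltW.
by lra.
Unshelve. all: by end_near. Qed.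

(** * Truncation errors of the difference quotients *)

Lemma coord_dot (R : realType) (x0 nu x : plane R) :
  dot nu nu = 1 ->
  dot (x - x0) (x - x0) = coorC x0 nu x ^+ 2 + coorS x0 nu x ^+ 2.
Proof.
move=> nu1; rewrite -[LHS]mulr1 -nu1 /coorC /coorS /dot /perp /=; ring.
Qed.

Lemma coord_decomp (R : realType) (x0 nu x : plane R) :
  dot nu nu = 1 ->
  x - x0 = (coorC x0 nu x * nu.1 - coorS x0 nu x * nu.2,
            coorC x0 nu x * nu.2 + coorS x0 nu x * nu.1).
Proof.
move=> nu1; rewrite [LHS]surjective_pairing; congr pair.
  rewrite -[LHS]mulr1 -nu1 /coorC /coorS /dot /perp /=; ring.
rewrite -[LHS]mulr1 -nu1 /coorC /coorS /dot /perp /=; ring.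
Qed.

(** For an angle of at most eta the sine is at most eta, so that S^2 is at most
    eta^2 (C^2 + S^2); for eta at most 1/2 the term with S^2 can be absorbed. *)
Lemma coorS_of_angle (R : realType) (x0 nu x : plane R) (eta : R) :
  dot nu nu = 1 -> line_angle x0 nu x <= eta -> eta <= 2^-1 ->
  `|coorS x0 nu x| <= 2 * eta * `|coorC x0 nu x|.
Proof.
move=> nu1 ang eta2; pose r := enorm (x - x0).
have r0 : 0 <= r := sqrtr_ge0 _.
have r2 : r ^+ 2 = coorC x0 nu x ^+ 2 + coorS x0 nu x ^+ 2.
  by rewrite enorm_sqr (coord_dot _ _ nu1).
have Sr : `|coorS x0 nu x| <= r.
  rewrite -(ler_pXn2r (n := 2)) ?nnegrE // real_normK ?num_real // r2.
  by rewrite lerDr sqr_ge0.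
have s1 : -1 <= `|sinphi x0 nu x| <= 1.
  rewrite (le_trans _ (normr_ge0 _)) ?lerN10 //= /sinphi normrM normfV.
  rewrite (ger0_norm r0) -/r; have [r_eq0|r_neq0] := eqVneq r 0.
    by rewrite r_eq0 invr0 mulr0.
  by rewrite ler_pdivrMr ?mul1r // lt_neqAle eq_sym r_neq0.
have a0 : 0 <= line_angle x0 nu x.
  rewrite /line_angle; have := asin_geNpi2 s1; have := asin_lepi2 s1.
  have := asinK s1; set a := asin _ => sa a1 a2.
  rewrite leNgt; apply/negP => a_lt0.
  have : 0 < sin (- a) \/ a = - (pi / 2).
    move: a2; rewrite le_eqVlt => /orP[/eqP|] a2; first by right.
    by left; apply: sin_gt0_pihalf; apply/andP; split; lra.
  rewrite sinN sa => -[|aE]; first by rewrite oppr_gt0 ltNge normr_ge0.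
  by move: sa; rewrite aE sinN sin_pihalf => /eqP; rewrite eq_sym gt_eqF //
    (lt_le_trans _ (normr_ge0 _)) // ltrN10.
have eta0 : 0 <= eta := le_trans a0 ang.
have se : `|sinphi x0 nu x| <= eta.
  rewrite -(asinK (x := `|_|)) // (le_trans (ler_norm _)) //.
  by rewrite (le_trans (sin_norm_le _)) // ger0_norm.
have Se : `|coorS x0 nu x| <= eta * r.
  have [r_eq0|r_neq0] := eqVneq r 0.
    by move: Sr; rewrite r_eq0 mulr0.
  have rp : 0 < r by rewrite lt_neqAle eq_sym r_neq0.
  by rewrite -ler_pdivrMr // -[r](ger0_norm r0) -normfV -normrM.
have Se2 : coorS x0 nu x ^+ 2 <= eta ^+ 2 * r ^+ 2.
  by rewrite -exprMn -real_normK ?num_real // lerXn2r ?nnegrE ?mulr_ge0.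
rewrite -(ler_pXn2r (n := 2)) ?nnegrE ?mulr_ge0 //.
rewrite exprMn !real_normK ?num_real //.
have e4 : eta ^+ 2 <= 4^-1.
  rewrite (_ : 4^-1 = 2^-1 ^+ 2) ?lerXn2r ?nnegrE //; by field.
have C0 := sqr_ge0 (coorC x0 nu x); have S0 := sqr_ge0 (coorS x0 nu x).
rewrite r2 mulrDr in Se2; have := ler_wpM2r S0 e4.
have := mulr_ge0 (sqr_ge0 eta) C0; rewrite [(2 * eta) ^+ 2]exprMn.
lra.
Qed.

(** In the axes nu, nu^perp the increment of phi is its Taylor polynomial in
    (C, S) up to eps (C^2 + S^2).  The moments leave exactly the second
    derivative along nu; as |S| is at most tau |C|, the remaining quadratic terms
    and the error are multiples of C^2, whose weighted sum is 2.  Nonnegativity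
    of the weights makes the bound independent of the resolution, although the
    weights grow like the inverse square of the distances. *)
Lemma wsum_second_order (R : realType) (phi : plane R -> R) (X : 'M[R]_2)
    (x0 nu : plane R) (s : seq (R * plane R)) (eps tau : R) :
  dot nu nu = 1 -> 0 <= eps -> 0 <= tau <= 1 ->
  (forall q, q \in s ->
    [/\ 0 <= q.1, `|coorS x0 nu q.2| <= tau * `|coorC x0 nu q.2| &
       `|phi q.2 - phi x0 - dot (grad phi x0) (q.2 - x0)
         - quad X (q.2 - x0) / 2| <= eps * dot (q.2 - x0) (q.2 - x0)]) ->
  \sum_(q <- s) q.1 * coorC x0 nu q.2 = 0 ->
  \sum_(q <- s) q.1 * coorS x0 nu q.2 = 0 ->
  \sum_(q <- s) q.1 * coorC x0 nu q.2 ^+ 2 = 2 ->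
  `|wsum s phi x0 - quad X nu| <= 4 * eps + 2 * tau * mx_size X.
Proof.
move=> nu1 eps0 /andP[tau0 tau1] sP sC sS sCC.
set gC := dot (grad phi x0) nu; set gS := dot (grad phi x0) (perp nu).
have M0 : 0 <= mx_size X by rewrite /mx_size !addr_ge0.
have -> : wsum s phi x0 - quad X nu = \sum_(q <- s) q.1 *
    (phi q.2 - phi x0 - gC * coorC x0 nu q.2 - gS * coorS x0 nu q.2
     - quad X nu / 2 * coorC x0 nu q.2 ^+ 2).
  transitivity (wsum s phi x0
    - gC * (\sum_(q <- s) q.1 * coorC x0 nu q.2)
    - gS * (\sum_(q <- s) q.1 * coorS x0 nu q.2)
    - quad X nu / 2 * (\sum_(q <- s) q.1 * coorC x0 nu q.2 ^+ 2)).
    by rewrite sC sS sCC; field.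
  rewrite /wsum !mulr_sumr -!sumrB; apply: eq_bigr => q _; ring.
have term q : q \in s -> `|q.1 *
    (phi q.2 - phi x0 - gC * coorC x0 nu q.2 - gS * coorS x0 nu q.2
     - quad X nu / 2 * coorC x0 nu q.2 ^+ 2)| <=
    (2 * eps + tau * mx_size X) * (q.1 * coorC x0 nu q.2 ^+ 2).
  move=> /sP[q0 SC tay].
  rewrite normrM (ger0_norm q0) [leRHS]mulrCA ler_wpM2l //.
  move: tay; rewrite (coord_dot _ _ nu1) (coord_decomp _ _ nu1) => tay.
  move: SC tay; set C := coorC _ _ _; set S := coorS _ _ _ => SC tay.
  pose b := 2 * (nu.1 * nu.2) * (X 1 1 - X 0 0)
    + (X 0 1 + X 1 0) * (nu.1 ^+ 2 - nu.2 ^+ 2).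
  have S2 : S ^+ 2 <= tau * C ^+ 2.
    rewrite -real_normK ?num_real // -[C ^+ 2]real_normK ?num_real //.
    rewrite (@le_trans _ _ ((tau * `|C|) ^+ 2)) ?lerXn2r ?nnegrE ?mulr_ge0 //.
    by rewrite exprMn ler_wpM2r ?sqr_ge0 // expr2 ler_piMl.
  have SC2 : `|C * S| <= tau * C ^+ 2.
    rewrite normrM (le_trans (ler_wpM2l _ SC)) //.
    by rewrite mulrCA -expr2 real_normK ?num_real.
  have bM : `|b| <= mx_size X.
    have [x2 y2] := (sqr_ge0 nu.1, sqr_ge0 nu.2).
    have n1 : nu.1 ^+ 2 + nu.2 ^+ 2 = 1 by rewrite -nu1 /dot !expr2.
    have h1 : `|2 * (nu.1 * nu.2)| <= 1.
      have := sqr_ge0 (nu.1 + nu.2); have := sqr_ge0 (nu.1 - nu.2).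
      by move=> ? ?; rewrite ler_norml; apply/andP; split; lra.
    have h2 : `|nu.1 ^+ 2 - nu.2 ^+ 2| <= 1.
      by rewrite ler_norml; apply/andP; split; lra.
    rewrite /b (le_trans (ler_normD _ _)) // !normrM /mx_size.
    have k1 := ler_piMl (normr_ge0 (X 1 1 - X 0 0)) h1.
    have k2 := ler_piMr (normr_ge0 (X 0 1 + X 1 0)) h2.
    have k3 := ler_normB (X 1 1) (X 0 0); rewrite !normrM in k1.
    lra.
  have pM : `|quad X (perp nu)| <= mx_size X.
    by apply: quad_le_size; rewrite -nu1 /dot /perp /=; ring.
  set E := (X in `|X| <= _) in tay.
  rewrite (_ : _ - _ = E + (b * (C * S) + quad X (perp nu) * S ^+ 2) / 2); last first.
    by rewrite /E /b /gC /gS /quad /dot /perp /=; field.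
  have t1 : `|b * (C * S)| <= mx_size X * (tau * C ^+ 2).
    by rewrite normrM ler_pM.
  have t2 : `|quad X (perp nu) * S ^+ 2| <= mx_size X * (tau * C ^+ 2).
    by rewrite normrM [`|S ^+ 2|]ger0_norm ?sqr_ge0 // ler_pM ?sqr_ge0.
  have t3 : eps * (C ^+ 2 + S ^+ 2) <= 2 * eps * C ^+ 2.
    rewrite -mulrA mulrCA ler_wpM2l // mulr_natl mulr2n lerD2l.
    by rewrite (le_trans S2) // ler_piMl ?sqr_ge0.
  rewrite (le_trans (ler_normD _ _)) // normrM normfV.
  have t4 := ler_normD (b * (C * S)) (quad X (perp nu) * S ^+ 2).
  by rewrite [`|2|]ger0_norm //; lra.
rewrite (le_trans (ler_norm_sum _ _ _)) //.
rewrite (_ : 4 * eps + _ = \sum_(q <- s) (2 * eps + tau * mx_size X) *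
    (q.1 * coorC x0 nu q.2 ^+ 2)); last by rewrite -mulr_sumr sCC; ring.
by rewrite big_seq [leRHS]big_seq; apply: ler_sum.
Qed.

(** The first-order analogue.  All points lie on the side sg = 1 or sg = -1, so
    the weighted sum of |C| is 1 and controls the error. *)
Lemma wsum_first_order (R : realType) (phi : plane R -> R) (p : plane R)
    (x0 nu : plane R) (s : seq (R * plane R)) (eps sg : R) :
  dot nu nu = 1 -> 0 <= eps -> sg ^+ 2 = 1 ->
  (forall q, q \in s ->
    [/\ 0 <= q.1, 0 <= sg * coorC x0 nu q.2,
       `|coorS x0 nu q.2| <= `|coorC x0 nu q.2| &
       `|phi q.2 - phi x0 - dot p (q.2 - x0)|
         <= eps * (`|(q.2 - x0).1| + `|(q.2 - x0).2|)]) ->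
  \sum_(q <- s) q.1 * coorC x0 nu q.2 = sg ->
  \sum_(q <- s) q.1 * coorS x0 nu q.2 = 0 ->
  `|wsum s phi x0 - sg * dot p nu| <= 4 * eps.
Proof.
move=> nu1 eps0 sg1 sP sC sS.
have unit_le (a b : R) : a ^+ 2 + b ^+ 2 = 1 -> `|a| <= 1.
  move=> ab; rewrite -(ler_pXn2r (n := 2)) ?nnegrE // real_normK ?num_real //.
  by rewrite expr1n -ab lerDl sqr_ge0.
have n1 : `|nu.1| <= 1 by apply: (unit_le _ nu.2); rewrite -nu1 /dot !expr2.
have n2 : `|nu.2| <= 1.
  by apply: (unit_le _ nu.1); rewrite -nu1 /dot !expr2 addrC.
have sg_norm : `|sg| = 1.
  by apply/eqP; rewrite -(eqrXn2 (n := 2)) // real_normK ?num_real // sg1 expr1n.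
set gS := dot p (perp nu).
have -> : wsum s phi x0 - sg * dot p nu = \sum_(q <- s) q.1 *
    (phi q.2 - phi x0 - dot p nu * coorC x0 nu q.2 - gS * coorS x0 nu q.2).
  transitivity (wsum s phi x0
    - dot p nu * (\sum_(q <- s) q.1 * coorC x0 nu q.2)
    - gS * (\sum_(q <- s) q.1 * coorS x0 nu q.2)).
    by rewrite sC sS mulr0 subr0 mulrC.
  rewrite /wsum !mulr_sumr -!sumrB; apply: eq_bigr => q _; ring.
have term q : q \in s -> `|q.1 *
    (phi q.2 - phi x0 - dot p nu * coorC x0 nu q.2 - gS * coorS x0 nu q.2)| <=
    4 * eps * (sg * (q.1 * coorC x0 nu q.2)).
  move=> /sP[q0 sgC SC tay].
  have CE : sg * coorC x0 nu q.2 = `|coorC x0 nu q.2|.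
    by rewrite -(ger0_norm sgC) normrM sg_norm mul1r.
  rewrite (_ : 4 * eps * _ = q.1 * (4 * eps * (sg * coorC x0 nu q.2))); last by ring.
  rewrite CE normrM (ger0_norm q0) ler_wpM2l //.
  move: tay; rewrite (coord_decomp _ _ nu1) /=.
  move: SC; set C := coorC _ _ _; set S := coorS _ _ _ => SC.
  rewrite (_ : _ - dot _ _ = phi q.2 - phi x0 - dot p nu * C - gS * S); last first.
    rewrite /gS /dot /perp /=; ring.
  move=> /le_trans; apply.
  rewrite (_ : 4 * eps * _ = eps * (4 * `|C|)); last by ring.
  rewrite ler_wpM2l //.
  have c1 := ler_piMr (normr_ge0 C) n1; have c2 := ler_piMr (normr_ge0 C) n2.
  have s1 := ler_piMr (normr_ge0 S) n1; have s2 := ler_piMr (normr_ge0 S) n2.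
  have k1 := ler_normB (C * nu.1) (S * nu.2).
  have k2 := ler_normD (C * nu.2) (S * nu.1).
  rewrite !normrM in k1 k2; lra.
rewrite (le_trans (ler_norm_sum _ _ _)) //.
rewrite (_ : 4 * eps = \sum_(q <- s) 4 * eps *
    (sg * (q.1 * coorC x0 nu q.2))); last first.
  by rewrite -!mulr_sumr sC -expr2 sg1 mulr1.
by rewrite big_seq [leRHS]big_seq; apply: ler_sum.
Qed.

(** * Convergence of the discrete operators at interior grid points *)

(** Only grid points in Omega: near a boundary point of Omega the two branches
    of the scheme have different limits, which are taken separately. *)
Definition grid_near (R : realType) (Omega : set (plane R))
    (D : discretisation R) (x : plane R) : set_system (R * plane R) :=
  within [set q | q.2 \in grid D q.1 /\ Omega q.2]
    (filter_prod (0 : R)^'+ (nbhs x)).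

Instance grid_near_filter (R : realType) (Omega : set (plane R))
  (D : discretisation R) (x : plane R) : Filter (grid_near Omega D x).
Proof. exact: within_filter. Qed.

Lemma grid_nearI (R : realType) (Omega : set (plane R))
    (D : discretisation R) (x : plane R) (A : R -> Prop) (B : plane R -> Prop)
    (P : R -> plane R -> Prop) :
  (\forall h \near 0^'+, A h) -> (\forall z \near x, B z) ->
  (forall h z, A h -> B z -> z \in grid D h -> Omega z -> P h z) ->
  \forall q \near grid_near Omega D x, P q.1 q.2.
Proof.
move=> hA zB AB; exists (A, B) => //= -[h z] [/= Ah Bz] [zG zO].
exact: AB.
Qed.

Lemma grid_near_fst (R : realType) (Omega : set (plane R))
    (D : discretisation R) (x : plane R) (A : R -> Prop) :
  (\forall h \near 0^'+, A h) -> \forall q \near grid_near Omega D x, A q.1.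
Proof.
move=> hA; have zT : \forall z \near x, True by exact: filterT.
exact: (grid_nearI (P := fun h _ => A h) hA zT).
Qed.

Lemma near_right_and (R : realType) (P Q : R -> Prop) :
  (\forall h \near 0^'+, P h) -> (\forall h \near 0^'+, Q h) ->
  \forall h \near 0^'+, P h /\ Q h.
Proof. exact: filterI. Qed.

Lemma norm_le_enorm (R : realType) (v : plane R) (r : R) :
  enorm v < r -> `|v| < r.
Proof.
move=> vr; rewrite plane_norm_lt.
have le_enorm (a : R) : a ^+ 2 <= dot v v -> `|a| < r.
  move=> av; rewrite (le_lt_trans _ vr) // -(ler_pXn2r (n := 2)) ?nnegrE ?sqrtr_ge0 //.
  by rewrite enorm_sqr real_normK ?num_real.
by rewrite !le_enorm // /dot -!expr2 ?lerDl ?lerDr sqr_ge0.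
Qed.

Lemma near_range (R : realType) (h0 : R) : 0 < h0 ->
  \forall h \near 0^'+, 0 < h < h0.
Proof.
move=> h00; near=> h; apply/andP; split; near: h.
  exact: nbhs_right_gt.
exact: nbhs_right_lt.
Unshelve. all: by end_near. Qed.

Lemma near_ball (R : realType) (x : plane R) (r : R) : 0 < r ->
  \forall z \near x, `|z - x| < r.
Proof.
move=> r0; apply/nbhs_ballP; exists r => //= z.
by rewrite -ball_normE /= distrC.
Qed.

Lemma dtheta_near (R : realType) (Omega : set (plane R))
    (D : discretisation R) (h0 K e : R) :
  grid_hyp Omega D h0 -> 0 < e -> \forall h \near 0^'+, K * dtheta D h <= e.
Proof.
move=> HG e0.
have : K * dtheta D h @[h --> 0^'+] --> K * 0.
  by apply: cvgM; [exact: cvg_cst|exact: cvg_dtheta HG].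
rewrite mulr0 => /cvgr0Pnorm_le /(_ _ e0); apply: filterS => h.
exact/le_trans/ler_norm.
Qed.

(** The truncation error is uniform over the finitely many directions, whose
    number grows as the grid is refined. *)
Lemma second_diff_near (R : realType) (Omega : set (plane R))
    (D : discretisation R) (h0 : R) (phi : plane R -> R) (x : plane R)
    (eps : R) :
  grid_hyp Omega D h0 -> smooth phi -> 0 < eps ->
  \forall q \near grid_near Omega D x, forall nu, direction D q.1 nu ->
    `|second_diff D q.1 phi q.2 nu - quad (hess phi x) nu| <= eps.
Proof.
move=> HG sphi eps0; set X := hess phi x.
have M0 : 0 <= mx_size X by rewrite /mx_size !addr_ge0.
have M1 : 0 < mx_size X + 1 by rewrite ltr_wpDl.
have e80 : 0 < eps / 8 by rewrite divr_gt0.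
have [r r0 tay] := taylor2 x sphi e80.
(* Half of eps goes to the Taylor error, 4 (eps / 8), and half to the
   deviation of the neighbours from the line, 2 tau M <= eps / 2. *)
pose tau := Num.min 1 (eps / (4 * (mx_size X + 1))).
have tau0 : 0 < tau by rewrite lt_min ltr01 divr_gt0 // mulr_gt0.
have tau1 : tau <= 1 by rewrite ge_min lexx.
have tauM : tau * mx_size X <= eps / 4.
  have : tau * (mx_size X + 1) <= eps / 4.
    rewrite -ler_pdivlMr // -mulrA -invfM.
    by rewrite ge_min lexx orbT.
  by lra.
have tau2 : 0 < tau / 2 by rewrite divr_gt0.
have [K angK] := grid_angle HG.
have hA := near_right_and (near_right_and (near_range (grid_h0 HG)) angK)
  (near_right_and (delta_near HG r0) (dtheta_near K HG tau2)).
apply: (grid_nearI (P := fun h z => forall nu, direction D h nu ->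
  `|second_diff D h phi z nu - quad X nu| <= eps) hA (near_ball x r0)).
move=> h z [[hh ang] [dr Kd]] zx zG zO nu dnu.
have nu1 := dot_direction dnu.
have [s [-> sP sC sS sCC]] := second_diff_stencil HG hh zG zO dnu.
apply: le_trans (wsum_second_order (eps := eps / 8) (tau := tau) nu1 _ _ _ sC sS sCC) _.
- exact: ltW.
- by rewrite (ltW tau0).
- move=> q /sP[q0 qG qd qS]; split => //.
    case: qS => [->|[al [j j4 qE]]].
      by rewrite normr0 mulr_ge0 // ltW.
    have := coorS_of_angle (x0 := z) (x := q.2) (eta := tau / 2) nu1.
    rewrite mulrCA divff // mulr1; apply; last by lra.
    by rewrite qE (le_trans (ang _ _ _ zG zO dnu al j4)).
  have := tay z (q.2 - z) zx (norm_le_enorm (lt_trans qd dr)).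
  by rewrite [z + _]addrC subrK.
- by lra.
Qed.

(** The two one-sided quotients tend to minus and plus the derivative along e,
    and the maximum of the two with 0 is its absolute value. *)
Lemma slope_near (R : realType) (Omega : set (plane R))
    (D : discretisation R) (h0 : R) (phi : plane R -> R) (x e : plane R)
    (eps : R) :
  grid_hyp Omega D h0 -> smooth phi -> coord_direction e -> 0 < eps ->
  \forall q \near grid_near Omega D x,
    `|slope (gnbr D q.1 q.2 e) phi q.2 e - `|dot (grad phi x) e| | <= eps.
Proof.
move=> HG sphi ce eps0; set p := grad phi x.
have e40 : 0 < eps / 4 by rewrite divr_gt0.
have [r r0 tay] := taylor1 x sphi e40.
have half0 : 0 < 2^-1 :> R by rewrite invr_gt0.
have [K angK] := grid_gangle HG.
have hA := near_right_and (near_right_and (near_range (grid_h0 HG)) angK)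
  (near_right_and (delta_near HG r0) (dtheta_near K HG half0)).
apply: (grid_nearI (P := fun h z =>
  `|slope (gnbr D h z e) phi z e - `|dot p e| | <= eps) hA (near_ball x r0)).
move=> h z [[hh ang] [dr Kd]] zx zG zO.
have e1 : dot e e = 1.
  by case: ce => ->; rewrite /dot /= ?mulr0 ?mulr1 ?addr0 ?add0r.
have quadr := gnbr_quadrant HG hh zG zO ce.
have [b [b0 -> [pC pS] [mC mS]]] := slope_stencil quadr.
have termP sg j : (1 <= j <= 4)%N ->
    0 <= sg * coorC z e (gnbr D h z e j) ->
    [/\ 0 <= b j, 0 <= sg * coorC z e (gnbr D h z e j),
       `|coorS z e (gnbr D h z e j)| <= `|coorC z e (gnbr D h z e j)| &
       `|phi (gnbr D h z e j) - phi z - dot p (gnbr D h z e j - z)|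
         <= eps / 4 * (`|(gnbr D h z e j - z).1| + `|(gnbr D h z e j - z).2|)].
  move=> j4 sgC; split => //; first exact: b0.
    have := coorS_of_angle (x0 := z) (x := gnbr D h z e j) (eta := 2^-1) e1.
    rewrite divff // mul1r; apply => //.
    by rewrite (le_trans (ang _ _ _ zG zO ce j4)).
  have [[_ jd _] _] := grid_gstencil HG hh zG zO ce j4.
  have := tay z (gnbr D h z e j - z) zx (norm_le_enorm (lt_trans jd dr)).
  by rewrite [z + _]addrC subrK.
have P : `|wsum [seq (b j, gnbr D h z e j) | j <- [:: 1; 4]%N] phi z
    - 1 * dot p e| <= 4 * (eps / 4).
  apply: (wsum_first_order e1 (ltW e40) _ _ pC pS); first by rewrite expr1n.
  move=> q; rewrite /= !inE => /orP[] /eqP -> /=; apply: termP => //;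
    rewrite mul1r.
    by have /andP[/ltW] := quadr 1%N isT.
  by have /andP[] := quadr 4%N isT.
have M : `|wsum [seq (b j, gnbr D h z e j) | j <- [:: 2; 3]%N] phi z
    - (-1) * dot p e| <= 4 * (eps / 4).
  apply: (wsum_first_order e1 (ltW e40) _ _ mC mS); first by rewrite sqrrN expr1n.
  move=> q; rewrite /= !inE => /orP[] /eqP -> /=; apply: termP => //;
    rewrite mulN1r oppr_ge0.
    by have /andP[] := quadr 2%N isT.
  by have /andP[/ltW] := quadr 3%N isT.
have -> : `|dot p e| = Num.max (Num.max (- dot p e) (dot p e)) 0.
  have [d0|d0] := leP 0 (dot p e).
    by rewrite ger0_norm // (max_r (x := - _)) ?max_l // (le_trans _ d0) ?oppr_le0.
  by rewrite ltr0_norm // (max_l (x := - _)) ?max_l ?oppr_ge0 ?ltW // (lt_trans d0) ?oppr_gt0.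
rewrite (le_trans (maxr_lipschitz _ _ _ _)) // subrr normr0 ge_max (ltW eps0) andbT.
rewrite (le_trans (maxr_lipschitz _ _ _ _)) // ge_max.
have e4E : 4 * (eps / 4) = eps by field.
move: P M; rewrite e4E mul1r mulN1r opprK => P M.
apply/andP; split; first by rewrite -normrN opprD opprK.
by rewrite -opprD normrN.
Qed.

Lemma dtheta_ge0 (R : realType) (D : discretisation R) (h : R) :
  0 <= dtheta D h.
Proof. by rewrite /dtheta divr_ge0 ?pi_ge0 ?mulr_ge0. Qed.

Lemma mx_size_ge0 (R : realType) (X : 'M[R]_2) : 0 <= mx_size X.
Proof. by rewrite /mx_size !addr_ge0. Qed.

(** Every discrete direction gives at least lambda1, up to the truncation error;
    conversely some discrete direction is within dtheta of a minimising one. *)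
Lemma lambda1_h_close (R : realType) (D : discretisation R) (h eps : R)
    (phi : plane R -> R) (z : plane R) (X : 'M[R]_2) :
  X 1 0 = X 0 1 -> (0 < nang D h)%N -> 0 <= eps ->
  (forall nu, direction D h nu ->
     `|second_diff D h phi z nu - quad X nu| <= eps) ->
  `|lambda1_h D h phi z - lambda1 X| <= eps + 2 * mx_size X * dtheta D h.
Proof.
move=> symX n0 eps0 sd.
have n20 : (0 < 2 * nang D h)%N by rewrite muln_gt0.
have k0 : 0 <= 2 * mx_size X * dtheta D h.
  by apply: mulr_ge0 (dtheta_ge0 _ _); apply: mulr_ge0 (mx_size_ge0 _).
have lower : lambda1 X - eps <= lambda1_h D h phi z.
  apply: le_min_upto => // j jn.
  have dj : direction D h (unit_dir (j%:R * dtheta D h)) by exists j.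
  have := sd _ dj; rewrite ler_norml => /andP[+ _].
  have := lambda1_le_quad symX (dot_unit_dir (j%:R * dtheta D h)); lra.
have [t /andP[t0 tpi] tE] := lambda1_attained symX.
have tn : 0 <= t <= (2 * nang D h)%:R * dtheta D h.
  by rewrite t0 natrM -mulrA nang_dtheta // mulrC divfK //.
have [j jn jt] := cover_angles n20 tn.
have dj : direction D h (unit_dir (j%:R * dtheta D h)) by exists j.
have upper : lambda1_h D h phi z <= lambda1 X + (eps + 2 * mx_size X * dtheta D h).
  apply: le_trans (min_upto_le _ jn) _.
  have := sd _ dj; have := quad_lipschitz X (j%:R * dtheta D h) t.
  have := ler_wpM2l (_ : 0 <= 2 * mx_size X) jt.
  rewrite mulr_ge0 ?mx_size_ge0 // => /(_ isT) k1 /le_trans /(_ k1).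
  rewrite tE !ler_norml => /andP[_ ?] /andP[_ ?]; lra.
rewrite ler_norml; apply/andP; split; lra.
Qed.

Lemma pos_prod_lipschitz (R : realType) (s s' p p' e M : R) :
  0 <= e -> `|s - p| <= e -> `|s' - p'| <= e -> `|p| <= M -> `|p'| <= M ->
  `|Num.max s 0 * Num.max s' 0 - Num.max p 0 * Num.max p' 0|
    <= e * (2 * M + e).
Proof.
move=> e0 sp sp' pM pM'.
have pos_le (a b : R) : `|Num.max a 0 - Num.max b 0| <= `|a - b|.
  rewrite (le_trans (maxr_lipschitz _ _ _ _)) // subrr normr0.
  by rewrite ge_max lexx normr_ge0.
have pos0 (a : R) : `|Num.max a 0| <= `|a|.
  by have := pos_le a 0; rewrite maxxx !subr0.
have sM : `|s| <= M + e.
  by rewrite -(subrK p s) addrC (le_trans (ler_normD _ _)) // lerD.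
rewrite (_ : _ - _ = Num.max s 0 * (Num.max s' 0 - Num.max p' 0) +
   (Num.max s 0 - Num.max p 0) * Num.max p' 0); last by ring.
rewrite (_ : e * _ = (M + e) * e + e * M); last by ring.
rewrite (le_trans (ler_normD _ _)) // !normrM lerD // ler_pM //.
- by rewrite (le_trans (pos0 _)).
- by rewrite (le_trans (pos_le _ _)).
- by rewrite (le_trans (pos_le _ _)).
- by rewrite (le_trans (pos0 _)).
Qed.

(** As for lambda1: orthogonal pairs give at least det^+ up to the truncation
    error, and some discrete pair is within dtheta of an eigenbasis. *)
Lemma det_h_close (R : realType) (D : discretisation R) (h eps e : R)
    (phi : plane R -> R) (z : plane R) (X : 'M[R]_2) :
  X 1 0 = X 0 1 -> (0 < nang D h)%N -> 0 <= eps ->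
  (forall nu, direction D h nu ->
     `|second_diff D h phi z nu - quad X nu| <= eps) ->
  eps + 2 * mx_size X * dtheta D h <= e ->
  `|det_h D h phi z - detp X| <= e * (2 * mx_size X + e).
Proof.
move=> symX n0 eps0 sd ee.
have k0 : 0 <= 2 * mx_size X * dtheta D h.
  by apply: mulr_ge0 (dtheta_ge0 _ _); apply: mulr_ge0 (mx_size_ge0 _).
have e0 : 0 <= e by lra.
have dotp s : dot (perp (unit_dir s)) (perp (unit_dir s)) = 1 :> R.
  by rewrite perp_unit_dir dot_unit_dir.
have lower : detp X - e * (2 * mx_size X + e) <= det_h D h phi z.
  apply: le_min_upto => // j jn /=.
  set nu := unit_dir _; have nu1 : dot nu nu = 1 := dot_unit_dir _.
  have s1 := sd _ (direction_unit_dir jn); have s2 := sd _ (direction_perp jn).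
  have := detp_le symX nu1.
  have := @pos_prod_lipschitz R (second_diff D h phi z nu)
    (second_diff D h phi z (perp nu)) (quad X nu) (quad X (perp nu)) e
    (mx_size X) e0.
  rewrite (le_trans s1) ?(le_trans s2) ?(quad_le_size _ nu1) ?(quad_le_size _ (dotp _)) //; last 2 first.
  - by lra.
  - by lra.
  move=> /(_ isT isT isT isT); rewrite ler_norml => /andP[+ _]; lra.
have [t /andP[t0 tpi] tE] := detp_attained symX.
have tn : 0 <= t <= (nang D h)%:R * dtheta D h by rewrite t0 nang_dtheta.
have [j jn jt] := cover_angles n0 tn.
have upper : det_h D h phi z <= detp X + e * (2 * mx_size X + e).
  apply: le_trans (min_upto_le _ jn) _ => /=.
  set nu := unit_dir _; have nu1 : dot nu nu = 1 := dot_unit_dir _.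
  have s1 := sd _ (direction_unit_dir jn); have s2 := sd _ (direction_perp jn).
  have q1 := quad_lipschitz X (j%:R * dtheta D h) t.
  have q2 := quad_lipschitz X (j%:R * dtheta D h + pi / 2) (t + pi / 2).
  have shift : j%:R * dtheta D h + pi / 2 - (t + pi / 2) = j%:R * dtheta D h - t.
    by rewrite opprD addrACA subrr addr0.
  rewrite shift -!perp_unit_dir -/nu in q2.
  have k1 : 2 * mx_size X * `|j%:R * dtheta D h - t| <= 2 * mx_size X * dtheta D h.
    by rewrite ler_wpM2l // mulr_ge0 ?mx_size_ge0.
  have close (a b c : R) : `|a - b| <= eps ->
      `|b - c| <= 2 * mx_size X * `|j%:R * dtheta D h - t| -> `|a - c| <= e.
    rewrite !ler_norml => /andP[? ?] /andP[? ?].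
    by apply/andP; split; lra.
  have := pos_prod_lipschitz e0 (close _ _ _ s1 q1) (close _ _ _ s2 q2)
    (quad_le_size _ (dot_unit_dir _)) (quad_le_size _ (dotp _)).
  by rewrite tE ler_norml => /andP[_ +]; lra.
rewrite ler_norml; apply/andP; split; lra.
Qed.

Lemma cvg_lambda1_h (R : realType) (Omega : set (plane R))
    (D : discretisation R) (h0 : R) (phi : plane R -> R) (x : plane R) :
  grid_hyp Omega D h0 -> smooth phi ->
  lambda1_h D q.1 phi q.2 @[q --> grid_near Omega D x]
    --> lambda1 (hess phi x).
Proof.
move=> HG sphi; apply/cvgrPdist_le => e e0.
have e20 : 0 < e / 2 by rewrite divr_gt0.
have sd := second_diff_near x HG sphi e20.
have hA := near_right_and (near_range (grid_h0 HG))
  (dtheta_near (2 * mx_size (hess phi x)) HG e20).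
have nb := grid_near_fst Omega D x hA.
apply: filterS (filterI sd nb) => -[h z] /= [sdq [hh dq]].
rewrite distrC.
have symX : hess phi x 1 0 = hess phi x 0 1.
  by rewrite /hess !mxE /= partial_sym.
rewrite (le_trans (lambda1_h_close symX (grid_nang HG hh) (ltW e20) sdq)) //.
by lra.
Qed.

Lemma cvg_det_h (R : realType) (Omega : set (plane R))
    (D : discretisation R) (h0 : R) (phi : plane R -> R) (x : plane R) :
  grid_hyp Omega D h0 -> smooth phi ->
  det_h D q.1 phi q.2 @[q --> grid_near Omega D x] --> detp (hess phi x).
Proof.
move=> HG sphi; apply/cvgrPdist_le => e e0.
set X := hess phi x; have M0 : 0 <= mx_size X := mx_size_ge0 X.
have M1 : 0 < 2 * mx_size X + 1 by rewrite ltr_wpDl // mulr_ge0.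
(* e' <= 1 makes e' (2 M + e') at most e' (2 M + 1) <= e. *)
pose e' := Num.min 1 (e / (2 * mx_size X + 1)).
have e'0 : 0 < e' by rewrite lt_min ltr01 divr_gt0.
have e'1 : e' <= 1 by rewrite ge_min lexx.
have e'e : e' * (2 * mx_size X + e') <= e.
  rewrite (@le_trans _ _ (e' * (2 * mx_size X + 1))) //.
    by rewrite ler_wpM2l ?(ltW e'0) // lerD2l.
  by rewrite -ler_pdivlMr // ge_min lexx orbT.
have e20 : 0 < e' / 2 by rewrite divr_gt0.
have sd := second_diff_near x HG sphi e20.
have hA := near_right_and (near_range (grid_h0 HG))
  (dtheta_near (2 * mx_size X) HG e20).
have nb := grid_near_fst Omega D x hA.
apply: filterS (filterI sd nb) => -[h z] /= [sdq [hh dq]].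
rewrite distrC.
have symX : X 1 0 = X 0 1 by rewrite /X /hess !mxE /= partial_sym.
apply: le_trans e'e.
by apply: (det_h_close symX (grid_nang HG hh) (ltW e20) sdq); lra.
Qed.

Lemma cvg_grad_sq (R : realType) (Omega : set (plane R))
    (D : discretisation R) (h0 : R) (phi : plane R -> R) (x : plane R) :
  grid_hyp Omega D h0 -> smooth phi ->
  grad_sq D q.1 phi q.2 @[q --> grid_near Omega D x]
    --> enorm (grad phi x) ^+ 2.
Proof.
move=> HG sphi.
have sl e : coord_direction e ->
    slope (gnbr D q.1 q.2 e) phi q.2 e @[q --> grid_near Omega D x] -->
    `|dot (grad phi x) e|.
  move=> ce; apply/cvgrPdist_le => eps eps0.
  by apply: filterS (slope_near x HG sphi ce eps0) => q; rewrite distrC.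
have -> : enorm (grad phi x) ^+ 2 = `|dot (grad phi x) (e1 R)| ^+ 2 +
    `|dot (grad phi x) (e2 R)| ^+ 2.
  rewrite enorm_sqr !real_normK ?num_real // /dot /e1 /e2 /=.
  by rewrite !mulr1 !mulr0 addr0 add0r !expr2.
rewrite /grad_sq !expr2.
by apply: cvgD; (under eq_fun do rewrite expr2);
  apply: cvgM; apply: sl; by [left|right].
Qed.

Lemma cvg_maxr (R : realType) (T : Type) (F : set_system T) (f f' : T -> R)
    (a a' : R) : Filter F ->
  f x @[x --> F] --> a -> f' x @[x --> F] --> a' ->
  Num.max (f x) (f' x) @[x --> F] --> Num.max a a'.
Proof.
move=> FF /cvgrPdist_lt fa /cvgrPdist_lt fa'; apply/cvgrPdist_lt => e e0.
apply: filterS2 (fa e e0) (fa' e e0) => x ax ax'.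
by rewrite (le_lt_trans (maxr_lipschitz _ _ _ _)) // gt_max ax.
Qed.

Lemma cvg_interior (R : realType) (Omega : set (plane R))
    (kappa phi : plane R -> R) (D : discretisation R) (h0 : R) (x : plane R) :
  hypH3 Omega kappa -> grid_hyp Omega D h0 -> smooth phi -> closure Omega x ->
  Num.max (- det_h D q.1 phi q.2 + kappa q.2 * (1 + grad_sq D q.1 phi q.2) ^+ 2)
    (- lambda1_h D q.1 phi q.2) @[q --> grid_near Omega D x]
    --> Gop kappa x (grad phi x) (hess phi x).
Proof.
move=> [kc _ _] HG sphi xO.
have kx : kappa q.2 @[q --> grid_near Omega D x] --> kappa x.
  apply/cvgrPdist_lt => e e0.
  have /cvgrPdist_lt/(_ _ e0) kz : kappa z @[z --> within (closure Omega) (nbhs x)]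
      --> kappa x.
    by move/subspace_continuousP: kc; exact.
  have hT : \forall h \near (0 : R)^'+, True by exact: filterT.
  apply: (grid_nearI (P := fun _ z => `|kappa x - kappa z| < e) hT kz).
  by move=> h z _ kzE _ zO; apply: kzE; exact: subset_closure.
have gx := @cvg_grad_sq _ _ _ _ _ x HG sphi.
apply: cvg_maxr; last by apply: cvgN; exact: cvg_lambda1_h HG sphi.
apply: cvgD; first by apply: cvgN; exact: cvg_det_h HG sphi.
apply: cvgM => //; rewrite expr2; under eq_fun do rewrite expr2.
by apply: cvgM; apply: cvgD => //; exact: cvg_cst.
Qed.

(** * Consistency of the scheme *)

Lemma second_diff_shift (R : realType) (D : discretisation R) (h c : R)
    (u : plane R -> R) (x0 nu : plane R) :
  second_diff D h (fun y => u y + c) x0 nu = second_diff D h u x0 nu.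
Proof.
rewrite /second_diff; case: (aligned D h x0 nu) => [w|].
  by rewrite /centred_diff; congr (_ * _); ring.
have shift a b : u a + c - (u b + c) = u a - u b.
  by rewrite opprD addrACA subrr addr0.
by rewrite /second_diff4 !shift.
Qed.

Lemma slope_shift (R : realType) (x : nat -> plane R) (c : R)
    (u : plane R -> R) (x0 e : plane R) :
  slope x (fun y => u y + c) x0 e = slope x u x0 e.
Proof.
have shift a b : u a + c - (u b + c) = u a - u b.
  by rewrite opprD addrACA subrr addr0.
by rewrite /slope !shift.
Qed.

(** At interior points the scheme sees only the increments of phi. *)
Lemma Fh_increments (R : realType) (Omega : set (plane R))
    (g kappa phi : plane R -> R) (D : discretisation R)
    (h : R) (x : plane R) (z c : R) :
  Omega x ->
  Fh Omega g kappa D h x z (fun y => c - phi y) =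
  Num.max (- det_h D h phi x + kappa x * (1 + grad_sq D h phi x) ^+ 2)
    (- lambda1_h D h phi x).
Proof.
move=> xO; rewrite /Fh mem_set //.
rewrite (_ : (fun y => - (c - phi y)) = (fun y => phi y + (- c))); last first.
  by apply/funext => y; rewrite opprB.
congr (Num.max (- _ + _ * (1 + _) ^+ 2) (- _)).
- by rewrite /det_h; congr min_upto; apply/funext => j /=;
    rewrite !second_diff_shift.
- by rewrite /grad_sq !slope_shift.
- by rewrite /lambda1_h; congr min_upto; apply/funext => j;
    rewrite second_diff_shift.
Qed.

Lemma limf_esup_le (R : realType) (S : choiceType) (T : filteredType S) (F : set_system T)
    (f : T -> R) (a : R) :
  (forall e : R, 0 < e -> \forall q \near F, f q <= a + e) ->
  (limf_esup (fun q => (f q)%:E) F <= a%:E)%E.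
Proof.
move=> fa; apply/lee_addgt0Pr => e e0; rewrite -EFinD.
apply: (@le_trans _ _ (ereal_sup ((fun q => (f q)%:E) @` [set q | f q <= a + e]))).
  by apply: ereal_inf_lbound; exists [set q | f q <= a + e] => //; exact: fa.
by apply: ub_ereal_sup => _ [q /= qa <-]; rewrite lee_fin.
Qed.

Lemma limf_einf_ge (R : realType) (S : choiceType) (T : filteredType S) (F : set_system T)
    (f : T -> R) (a : R) : Filter F ->
  (forall e : R, 0 < e -> \forall q \near F, a - e <= f q) ->
  (a%:E <= limf_einf (fun q => (f q)%:E) F)%E.
Proof.
move=> FF fa; rewrite /limf_einf leeNr -EFinN; apply: limf_esup_le => e e0.
by apply: filterS (fa e e0) => q ?; lra.
Qed.

Instance consistency_filterP (R : realType) (G : R -> seq (plane R))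
  (x : plane R) : Filter (consistency_filter G x).
Proof. exact: within_filter. Qed.

(** A neighbourhood of 0 on the right suffices for the resolution, the filter
    being restricted to h > 0. *)
Lemma consistency_near (R : realType) (G : R -> seq (plane R)) (x : plane R)
    (A : R -> Prop) (B : plane R -> Prop) (C : plane R -> Prop) (E : R -> Prop) :
  (\forall h \near 0^'+, A h) -> (\forall y \near x, B y) ->
  (\forall z \near x, C z) -> (\forall xi \near (0 : R), E xi) ->
  \forall q \near consistency_filter G x,
    [/\ A q.1.1.1, B q.1.1.2, C q.1.2, E q.2 & q.1.2 \in G q.1.1.1].
Proof.
move=> hA yB zC xiE.
have nb : nbhs ((0 : R), x, x, (0 : R))
    [set q | (0 < q.1.1.1 -> A q.1.1.1) /\ B q.1.1.2 /\ C q.1.2 /\ E q.2].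
  exists ([set p : R * plane R * plane R |
    (0 < p.1.1 -> A p.1.1) /\ B p.1.2 /\ C p.2], E); last first.
    by move=> -[p xi] /= [[? [? ?]] ?].
  split => //=.
  exists ([set p : R * plane R | (0 < p.1 -> A p.1) /\ B p.2], C); last first.
    by move=> -[p z] /= [[? ?] ?].
  split => //=.
  exists ([set h : R | 0 < h -> A h], B); last by move=> -[h y] /= [? ?].
  by split.
by apply: filterS nb => q [qA [qB [qC qE]]] [q0 qG]; split => //; exact: qA.
Qed.

(** Near an interior point only interior grid points occur.  Near a boundary
    point there are two kinds of grid points: the interior ones, where the
    scheme tends to G, and those on the boundary, where it tends to
    phi(x) - g(x). *)
Lemma Fh_near (R : realType) (Omega : set (plane R))
    (g kappa phi : plane R -> R) (D : discretisation R) (h0 e : R)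
    (x : plane R) :
  open Omega -> hypH2 Omega g -> hypH3 Omega kappa -> grid_hyp Omega D h0 ->
  smooth phi -> closure Omega x -> 0 < e ->
  \forall q \near consistency_filter (grid D) x,
    let v := Fh Omega g kappa D q.1.1.1 q.1.2 (phi q.1.1.2 + q.2)
               (fun y => phi q.1.1.2 - phi y) in
    `|v - Gop kappa x (grad phi x) (hess phi x)| <= e \/
    ~ Omega x /\ `|v - (phi x - g x)| <= e.
Proof.
move=> oO gc H3 HG sphi xO e0.
have e30 : 0 < e / 3 by rewrite divr_gt0.
have /cvgrPdist_le/(_ _ e0) [[A B] [/= hA zB] AB] := cvg_interior H3 HG sphi xO.
have zC : \forall z \near x, (Omega x -> Omega z) /\
    (~ Omega x -> boundary Omega z -> `|g x - g z| < e / 3).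
  have [xi|xb] := pselect (Omega x).
    have := open_nbhs_nbhs (conj oO xi).
    by apply: filterS => z zO; split.
  have bx : boundary Omega x by split => // /interior_subset.
  have /cvgrPdist_lt/(_ _ e30) : g z @[z --> within (boundary Omega) (nbhs x)]
      --> g x.
    by move/subspace_continuousP: gc; exact.
  move=> gz; apply: (@filterS _ (nbhs x)) gz => z zP; split => // _.
have xiE : \forall xi \near (0 : R), `|xi| < e / 3.
  apply/nbhs_ballP; exists (e / 3) => //= z.
  by rewrite -ball_normE /= sub0r normrN.
have zBC : \forall z \near x, B z /\ (Omega x -> Omega z) /\
    (~ Omega x -> boundary Omega z -> `|g x - g z| < e / 3).
  exact: filterI zB zC.
have nb := @consistency_near R (grid D) x _ _ _ _
  (near_right_and (near_range (grid_h0 HG)) hA) (smooth_near x sphi e30)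
  zBC xiE.
apply: filterS nb => -[[[h y] z] xi] /= [[hh Ah] yx [Bz [zO gz]] xi3 zG].
have [zin|zout] := pselect (Omega z).
  by left; rewrite Fh_increments // distrC; exact: (AB (h, z)).
have xout : ~ Omega x by move=> /zO.
right; split => //; rewrite /Fh memNset //.
have zb : boundary Omega z.
  by split; [exact: (grid_sub HG hh zG)|move=> /interior_subset].
have := gz xout zb; move: yx xi3; rewrite !ltr_norml ler_norml.
by move=> /andP[? ?] /andP[? ?] /andP[? ?]; apply/andP; split; lra.
Qed.

(** Both possible limits lie between the lower and the upper operator. *)
Lemma consistent_Fh (R : realType) (Omega : set (plane R))
    (g kappa : plane R -> R) (D : discretisation R) (h0 : R) :
  open Omega -> hypH2 Omega g -> hypH3 Omega kappa -> grid_hyp Omega D h0 ->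
  consistent Omega (grid D) (Fh Omega g kappa D)
    (Flow Omega g kappa) (Fup Omega g kappa).
Proof.
move=> oO H2 H3 HG phi sphi x xO T.
pose v (q : R * plane R * plane R * R) :=
  Fh Omega g kappa D q.1.1.1 q.1.2 (phi q.1.1.2 + q.2)
     (fun y => phi q.1.1.2 - phi y).
have -> : T = (fun q => (v q)%:E) by apply/funext => -[[[h y] z] xi].
rewrite /Fup /Flow; set G := Gop _ _ _ _; split.
  apply: limf_esup_le => e e0.
  apply: filterS (Fh_near oO H2 H3 HG sphi xO e0) => q /=.
  rewrite -/(v q) -/G !ler_norml => -[/andP[_ vG]|[xout /andP[_ vg]]].
    by case: ifPn => _; [lra|have := le_max G (phi x - g x) G; rewrite lexx orbT; lra].
  by rewrite memNset //; have := le_max (phi x - g x) (phi x - g x) G; rewrite lexx; lra.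
apply: limf_einf_ge => e e0.
apply: filterS (Fh_near oO H2 H3 HG sphi xO e0) => q /=.
rewrite -/(v q) -/G !ler_norml => -[/andP[vG _]|[xout /andP[vg _]]].
  by case: ifPn => _; [lra|have := ge_min G (phi x - g x) G; rewrite lexx orbT; lra].
by rewrite memNset //; have := ge_min (phi x - g x) (phi x - g x) G; rewrite lexx; lra.
Qed.

Theorem lemma41 (R : realType) (Omega : set (R * R)) (g kappa : R * R -> R)
    (D : discretisation R) (h0 : R)
    (H1 : hypH1 Omega) (H2 : hypH2 Omega g) (H3 : hypH3 Omega kappa)
    (H4 : hypH4 Omega kappa) (HG : grid_hyp Omega D h0) :
  [/\ consistent Omega (grid D) (Fh Omega g kappa D)
        (Flow Omega g kappa) (Fup Omega g kappa),
      monotone_scheme (grid D) h0 (Fh Omega g kappa D) &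
      lipschitz_scheme (grid D) h0 (Fh Omega g kappa D)].
Proof.
case: H1 => oO _ _ _; split.
- exact: consistent_Fh oO H2 H3 HG.
- apply: monotone_Fh HG => x xO; case: H3 => _ kappa0 _.
  exact/kappa0/subset_closure.
- exact: lipschitz_Fh HG.
Qed.
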